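(* Let $X$ and $Y$ be metric spaces with bounded geometry. The following are equivalent: (1) $X$ and $Y$ are bijectively coarsely equivalent. (2) For every $p\in[1,\infty)$, there is an isometric isomorphism $\phi:B^p_u(X)\to B^p_u(Y)$ such that $\phi(\ell^\infty(X))=\ell^\infty(Y)$. (3) $B^p_u(X)$ and $B^p_u(Y)$ are isometrically isomorphic for every $p\in[1,\infty)$. (4) $B^p_u(X)$ and $B^p_u(Y)$ are isometrically isomorphic for some $p\in[1,\infty)\setminus\{2\}$. (5) For some $p\in[1,\infty)$, there is an isometric isomorphism $\phi:B^p_u(X)\to B^p_u(Y)$ such that $\phi(\ell^\infty(X))=\ell^\infty(Y)$.
   Context: A metric space $X$ has bounded geometry if for all $R\ge 0$ there is $N_R\in\mathbb{N}$ such that every ball of radius $R$ in $X$ has at most $N_R$ elements. A map $f:X\to Y$ is uniformly expansive if for all $R>0$ there is $S>0$ such that $d(x_1,x_2)\le R$ implies $d(f(x_1),f(x_2))\le S$. Two maps $f,g:X\to Y$ are close if there is $C>0$ with $d(f(x),g(x))\le C$ for all $x\in X$. A map $f:X\to Y$ is a coarse equivalence if it is uniformly expansive and there is a uniformly expansive map $g:Y\to X$ such that $f\circ g$ and $g\circ f$ are close to the identity maps. $X$ and $Y$ are bijectively coarsely equivalent if there is a bijection $f:X\to Y$ that is a coarse equivalence. For $T\in B(\ell^p(X))$ put $T_{xy}=(T\delta_y)(x)$; the propagation of $T$ is $\sup\{d(x,y):T_{xy}\ne 0\}$. The $\ell^p$ uniform Roe algebra $B^p_u(X)$ is the operator norm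 closure in $B(\ell^p(X))$ of the algebra of all bounded operators on $\ell^p(X)$ with finite propagation. $\ell^\infty(X)\subseteq B^p_u(X)$ denotes the subalgebra of multiplication operators on $\ell^p(X)$ by bounded functions. Isometric isomorphism means an isometric (complex-linear, multiplicative, bijective) algebra isomorphism. *)

(* Defs.v *)
From HB Require Import structures.
From mathcomp Require Import all_boot all_order all_algebra.
From mathcomp Require Import complex.
From mathcomp Require Import all_classical all_reals all_analysis.
From mathcomp Require Import ring.

Set Implicit Arguments.
Unset Strict Implicit.
Unset Printing Implicit Defensive.

Import Order.TTheory GRing.Theory Num.Theory.
Import numFieldNormedType.Exports.
Import ComplexField.

Local Open Scope classical_set_scope.
Local Open Scope ring_scope.
Local Open Scope complex_scope.

Section esum_scale.
Context {R : realType} {T : choiceType}.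

Lemma le_esumZl (c : R) (a : T -> \bar R) : 0 <= c -> (forall x, 0 <= a x)%E ->
  (\esum_(x in [set: T]) (c%:E * a x) <= c%:E * \esum_(x in [set: T]) a x)%E.
Proof.
move=> c0 a0; apply: ge_ereal_sup => /= _ [A [finA AT]] <-.
rewrite -ge0_mule_fsumr//; apply: lee_wpmul2l; first by rewrite lee_fin.
by apply: esum_ge; exists A.
Qed.

Lemma esumZl (c : R) (a : T -> \bar R) : 0 <= c -> (forall x, 0 <= a x)%E ->
  (\esum_(x in [set: T]) (c%:E * a x) = c%:E * \esum_(x in [set: T]) a x)%E.
Proof.
move=> c0 a0; apply/eqP; rewrite eq_le le_esumZl//=.
have [->|cn0] := eqVneq c 0.
  by rewrite mul0e esum_ge0// => x _; rewrite mul0e.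
have cp : 0 < c by rewrite lt_neqAle eq_sym cn0.
rewrite -lee_pdivlMl//; apply: le_trans (le_esumZl _ _).
- by apply: le_esum => x _; rewrite muleA -EFinM mulVf// mul1e.
- by rewrite invr_ge0.
- by move=> x; rewrite mule_ge0// lee_fin.
Qed.

End esum_scale.

Section lp_space.
Context {R : realType}.
Implicit Types p a b : R.

Let convex_pow p (t u v : R) : 1 <= p -> 0 <= t <= 1 -> 0 <= u -> 0 <= v ->
  (t * u + (1 - t) * v) `^ p <= t * u `^ p + (1 - t) * v `^ p.
Proof.
move=> p1 t01 u0 v0.
have := @convex_powR R p p1 (Itv01 (andP t01).1 (andP t01).2) u v.
rewrite !inE/= !in_itv/= !andbT => /(_ u0 v0).
by rewrite !convRE.
Qed.

Definition lp_sum p (X : choiceType) (f : X -> R[i]^o) : \bar R :=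
  \esum_(x in [set: X]) (Normc.normc (f x) `^ p)%:E.

Lemma lp_sum_ge0 p (X : choiceType) (f : X -> R[i]^o) : (0 <= lp_sum p f)%E.
Proof. by apply: esum_ge0 => x _; rewrite lee_fin powR_ge0. Qed.

Let normc_ge0 (z : R[i]) : 0 <= Normc.normc z.
Proof. by case: z => x y; exact: sqrtr_ge0. Qed.

Lemma lp_sumD p (X : choiceType) (f g : X -> R[i]^o) a b : 1 <= p ->
  0 < a -> 0 < b -> (lp_sum p f <= (a `^ p)%:E)%E ->
  (lp_sum p g <= (b `^ p)%:E)%E ->
  (lp_sum p (f + g)%R <= ((a + b) `^ p)%:E)%E.
Proof.
move=> p1 a0 b0 fa gb; set t := a / (a + b).
have ab0 : 0 < a + b by rewrite addr_gt0.
have t0 : 0 <= t by rewrite divr_ge0// ltW.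
have tE : 1 - t = b / (a + b).
  by rewrite -[1](divff (lt0r_neq0 ab0)) -mulrBl addrAC subrr add0r.
have t1 : 0 <= 1 - t by rewrite tE divr_ge0// ltW.
set k := (a + b) `^ p.
have k0 : 0 <= k by exact: powR_ge0.
pose k1 := k * t / a `^ p; pose k2 := k * (1 - t) / b `^ p.
have k10 : 0 <= k1 by apply: divr_ge0; [exact: mulr_ge0|exact: powR_ge0].
have k20 : 0 <= k2 by apply: divr_ge0; [exact: mulr_ge0|exact: powR_ge0].
have -> : k%:E = (k1%:E * (a `^ p)%:E + k2%:E * (b `^ p)%:E)%E.
  by rewrite -!EFinM -EFinD !divfK ?lt0r_neq0 ?powR_gt0// -mulrDr subrKC mulr1.
apply: (@le_trans _ _ (k1%:E * lp_sum p f + k2%:E * lp_sum p g)%E); last first.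
  by apply: leeD; apply: lee_wpmul2l; rewrite ?lee_fin.
have pge0 (h : X -> R[i]^o) x : (0 <= (Normc.normc (h x) `^ p)%:E)%E.
  by rewrite lee_fin powR_ge0.
rewrite /lp_sum -!esumZl// -esumD; last 2 first.
- by move=> x _; rewrite mule_ge0.
- by move=> x _; rewrite mule_ge0.
apply: le_esum => x _; rewrite -!EFinM -EFinD lee_fin.
set u := Normc.normc (f x); set v := Normc.normc (g x).
have u0 : 0 <= u by exact: normc_ge0.
have v0 : 0 <= v by exact: normc_ge0.
apply: (@le_trans _ _ ((u + v) `^ p)).
  rewrite ge0_ler_powR ?nnegrE ?addr_ge0// ?(le_trans _ p1)//.
  exact: le_normcD.
have -> : u + v = (a + b) * (t * (u / a) + (1 - t) * (v / b)).
  by rewrite tE /t; field; rewrite !lt0r_neq0.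
have ua0 : 0 <= u / a by rewrite divr_ge0// ltW.
have vb0 : 0 <= v / b by rewrite divr_ge0// ltW.
have s0 : 0 <= t * (u / a) + (1 - t) * (v / b).
  by apply: addr_ge0; exact: mulr_ge0.
rewrite (powRM _ (ltW ab0) s0) -/k.
apply: (@le_trans _ _ (k * (t * (u / a) `^ p + (1 - t) * (v / b) `^ p))).
  rewrite ler_wpM2l// convex_pow// t0/=; by rewrite -subr_ge0.
have powRV (c : R) : 0 < c -> c^-1 `^ p = (c `^ p)^-1.
  by move=> c0; rewrite -powR_inv1 ?(ltW c0)// -powRrM mulN1r powRN.
rewrite (powRM _ u0) ?invr_ge0 ?(ltW a0)// (powRM _ v0) ?invr_ge0 ?(ltW b0)//.
rewrite !powRV// /k1 /k2.
set A := a `^ p; set B := b `^ p; set U := u `^ p; set V := v `^ p.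
suff -> : k * (t * (U / A) + (1 - t) * (V / B)) =
          k * t / A * U + k * (1 - t) / B * V by [].
ring.
Qed.

Lemma lp_sumZ p (X : choiceType) (c : R[i]) (f : X -> R[i]^o) :
  lp_sum p (c *: f)%R = ((Normc.normc c `^ p)%:E * lp_sum p f)%E.
Proof.
rewrite /lp_sum -esumZl ?powR_ge0//; last by move=> x; rewrite lee_fin powR_ge0.
by apply: eq_esum => x _; rewrite -EFinM /= Normc.normcM powRM.
Qed.

Definition lp_pred p (X : choiceType) : {pred X -> R[i]^o} :=
  mem [set f : X -> R[i]^o | (lp_sum p f < +oo)%E].

Definition lp_normf p (X : choiceType) (f : X -> R[i]^o) : R :=
  fine (lp_sum p f) `^ p^-1.

Lemma lp_normf_ge0 p (X : choiceType) (f : X -> R[i]^o) : 0 <= lp_normf p f.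
Proof. exact: powR_ge0. Qed.

Lemma lp_normfP p (X : choiceType) (f : X -> R[i]^o) : 1 <= p ->
  (lp_sum p f < +oo)%E -> lp_sum p f = (lp_normf p f `^ p)%:E.
Proof.
move=> p1 fp; have p0 : p != 0 by rewrite gt_eqF// (lt_le_trans _ p1).
rewrite /lp_normf -powRrM mulVf// powRr1 ?fine_ge0 ?lp_sum_ge0//.
by rewrite fineK// ge0_fin_numE// lp_sum_ge0.
Qed.

Lemma lp_normf_le p (X : choiceType) (f : X -> R[i]^o) a : 1 <= p -> 0 <= a ->
  (lp_sum p f <= (a `^ p)%:E)%E -> lp_normf p f <= a.
Proof.
move=> p1 a0 fa; have p0 : 0 < p by rewrite (lt_le_trans _ p1).
rewrite -[leRHS](powRr1 a0) -(divff (lt0r_neq0 p0)) powRrM.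
have ff : lp_sum p f \is a fin_num.
  by rewrite ge0_fin_numE ?lp_sum_ge0// (le_lt_trans fa)// ltry.
rewrite ge0_ler_powR ?nnegrE ?invr_ge0 ?(ltW p0)//.
- by rewrite fine_ge0// lp_sum_ge0.
- exact: powR_ge0.
- by rewrite -lee_fin fineK.
Qed.

Let lp_norm_bound p (X : choiceType) (f : X -> R[i]^o) e : 1 <= p -> 0 < e ->
  (lp_sum p f < +oo)%E -> (lp_sum p f <= ((lp_normf p f + e) `^ p)%:E)%E.
Proof.
move=> p1 e0 fp; rewrite lp_normfP// lee_fin ge0_ler_powR ?nnegrE//.
- by rewrite (le_trans _ p1).
- exact: lp_normf_ge0.
- by rewrite addr_ge0 ?lp_normf_ge0// ltW.
- by rewrite lerDl ltW.
Qed.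

Lemma lp_sumD_lty p (X : choiceType) (f g : X -> R[i]^o) : 1 <= p ->
  (lp_sum p f < +oo)%E -> (lp_sum p g < +oo)%E -> (lp_sum p (f + g)%R < +oo)%E.
Proof.
move=> p1 fp gp.
have h (a : R) : 0 <= a -> 0 < a + 1 by move=> a0; rewrite ltr_wpDl.
apply: le_lt_trans (ltry _).
apply: (lp_sumD p1 _ _ (lp_norm_bound p1 ltr01 fp) (lp_norm_bound p1 ltr01 gp));
  exact/h/lp_normf_ge0.
Qed.

Lemma lp_normfD p (X : choiceType) (f g : X -> R[i]^o) : 1 <= p ->
  (lp_sum p f < +oo)%E -> (lp_sum p g < +oo)%E ->
  lp_normf p (f + g) <= lp_normf p f + lp_normf p g.
Proof.
move=> p1 fp gp; apply/ler_addgt0Pr => e e0.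
have e2 : 0 < e / 2 by rewrite divr_gt0.
rewrite (splitr e) addrACA; apply: lp_normf_le => //.
  by rewrite !addr_ge0 ?lp_normf_ge0// ltW.
apply: lp_sumD => //; try exact: lp_norm_bound.
- by apply: ltr_wpDl; [exact: lp_normf_ge0|].
- by apply: ltr_wpDl; [exact: lp_normf_ge0|].
Qed.

Lemma lp_normfZ p (X : choiceType) (c : R[i]) (f : X -> R[i]^o) : 1 <= p ->
  (lp_sum p f < +oo)%E ->
  lp_normf p (c *: f) = Normc.normc c * lp_normf p f.
Proof.
move=> p1 fp; have p0 : p != 0 by rewrite gt_eqF// (lt_le_trans _ p1).
have ff : lp_sum p f \is a fin_num by rewrite ge0_fin_numE ?lp_sum_ge0.
rewrite /lp_normf lp_sumZ fineM//= powRM ?powR_ge0 ?fine_ge0 ?lp_sum_ge0//.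
by rewrite -powRrM mulfV// powRr1 ?normc_ge0.
Qed.

End lp_space.

(* The proof of 1 <= p is a parameter so that the norm instance below, which
   needs it, can be inferred from the type. *)
Record lp (R : realType) (p : R) (p1 : 1 <= p) (X : choiceType) :=
  Lp { lp_fun :> X -> R[i]^o ; _ : lp_fun \in @lp_pred R p X }.

Section lp_type.
Context {R : realType} (p : R) (p1 : 1 <= p) (X : choiceType).

Let pred0 : (0 : X -> R[i]^o) \in @lp_pred R p X.
Proof.
rewrite inE/= /lp_sum esum1// => x _.
have -> : Normc.normc ((0 : X -> R[i]^o) x) = 0 by exact: Normc.normc0.
by rewrite powR0// gt_eqF// (lt_le_trans _ p1).
Qed.

Notation lpX := (lp p1 X).

Lemma lp_submod_closed : submod_closed (@lp_pred R p X).
Proof.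
split=> [//|c f g]; rewrite !inE/= => fp gp; apply: lp_sumD_lty => //.
by rewrite lp_sumZ lte_mul_pinfty ?lee_fin ?powR_ge0.
Qed.

HB.instance Definition _ :=
  GRing.isSubmodClosed.Build R[i] (X -> R[i]^o) (@lp_pred R p X) lp_submod_closed.

HB.instance Definition _ := [isSub for @lp_fun R p p1 X].
HB.instance Definition _ := [Choice of lpX by <:].
HB.instance Definition _ := [SubChoice_isSubLmodule of lpX by <:].

Definition lpnorm (f : lpX) : R := lp_normf p f.

Lemma lpP (f : lpX) : (lp_sum p f < +oo)%E.
Proof. by have := valP f; rewrite inE. Qed.

Let lpnormD (f g : lpX) : (lpnorm (f + g))%:C <= (lpnorm f)%:C + (lpnorm g)%:C.
Proof.
by rewrite -rmorphD/= lecR; apply: lp_normfD => //; exact: lpP.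
Qed.

Let lpnormZ (c : R[i]) (f : lpX) : (lpnorm (c *: f))%:C = `|c| * (lpnorm f)%:C.
Proof. by rewrite /lpnorm/= lp_normfZ ?lpP// rmorphM. Qed.

Let lpnorm_eq0 (f : lpX) : (lpnorm f)%:C = 0 -> f = 0.
Proof.
move=> [] /eqP; rewrite /lpnorm => f0.
have p0 : 0 < p by rewrite (lt_le_trans _ p1).
have s0 : lp_sum p f = 0%E.
  by rewrite lp_normfP ?lpP// (eqP f0) powR0// gt_eqF.
apply/val_inj/funext => x /=; apply: Normc.eq0_normc.
have : ((Normc.normc (f x) `^ p)%:E <= 0)%E.
  rewrite -s0; apply: esum_ge; exists [set x]; first by split.
  by rewrite fsbig_set1.
rewrite lee_fin => fx0.
have : Normc.normc (f x) `^ p == 0 by rewrite eq_le fx0 powR_ge0.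
by rewrite powR_eq0 => /andP[/eqP].
Qed.

HB.instance Definition _ :=
  Lmodule_isNormed.Build R[i] lpX lpnormD lpnormZ lpnorm_eq0.

Lemma lp_normE (f : lpX) : `|f| = (lpnorm f)%:C.
Proof. by []. Qed.

End lp_type.

Section operators.
Context {R : realType}.

Definition bounded_operator (V : normedModType R[i]) : set (V -> V) :=
  [set T | linear T /\
    exists M : R, forall v : V, `|T v| <= M%:C * `|v| ].

(* The norm of a normedModType R[i] takes its (real) values in R[i]; Re brings
   them back to R. *)
Definition opnorm (V : normedModType R[i]) (T : V -> V) : R :=
  sup [set complex.Re `|T v| | v in [set v : V | `|v| <= 1]].

Definition opnorm_closure (V : normedModType R[i]) (A : set (V -> V)) :
    set (V -> V) :=
  [set T | bounded_operator T /\
    forall e : R, 0 < e -> exists2 S, A S & opnorm (T - S) < e].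

(* phi is only constrained on A; its values outside A are irrelevant. *)
Definition isometric_isomorphism (V W : normedModType R[i])
    (A : set (V -> V)) (B : set (W -> W)) (phi : (V -> V) -> (W -> W)) : Prop :=
  [/\ set_bij A B phi,
      forall (c : R[i]) S T, A S -> A T -> phi (c *: S + T) = c *: phi S + phi T,
      forall S T, A S -> A T -> phi (S \o T) = phi S \o phi T &
      forall T, A T -> opnorm (phi T) = opnorm T].

Definition isometrically_isomorphic (V W : normedModType R[i])
    (A : set (V -> V)) (B : set (W -> W)) : Prop :=
  exists phi, isometric_isomorphism A B phi.

End operators.

Section delta.
Context {R : realType} (p : R) (p1 : 1 <= p) (X : choiceType).

Definition delta_fun (y : X) : X -> R[i]^o := fun x => (x == y)%:R.

Lemma delta_fun_lp y : delta_fun y \in @lp_pred R p X.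
Proof.
have p0 : p != 0 by rewrite gt_eqF// (lt_le_trans _ p1).
rewrite inE/= /lp_sum (esumID [set y])//=; last by move=> x _; rewrite lee_fin powR_ge0.
rewrite !setTI.
rewrite [X in (_ + X)%E]esum1 => [|x /= xy].
  by rewrite esum_set1 ?lee_fin ?powR_ge0// adde0 ltry.
have -> : delta_fun y x = 0 by rewrite /delta_fun; case: eqP.
have -> : Normc.normc (0 : R[i]) = 0 by exact: Normc.normc0.
by rewrite powR0.
Qed.

Definition delta (y : X) : lp p1 X := Lp p1 (delta_fun_lp y).

Definition matrix_entry (T : lp p1 X -> lp p1 X) (x y : X) : R[i] :=
  T (delta y) x.

End delta.

Section roe_algebra.
Context {R : realType} (p : R) (p1 : 1 <= p) (X : metricType R).

Definition propagation (T : lp p1 X -> lp p1 X) : \bar R :=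
  ereal_sup [set r | exists x y, matrix_entry T x y != 0 /\ r = (mdist x y)%:E].

(* An operator with zero matrix has propagation -oo here rather than 0, which
   does not affect finiteness. *)
Definition finite_propagation : set (lp p1 X -> lp p1 X) :=
  [set T | bounded_operator T /\ (propagation T < +oo)%E].

Definition uniform_roe : set (lp p1 X -> lp p1 X) :=
  opnorm_closure finite_propagation.

Definition linfty : set (lp p1 X -> lp p1 X) :=
  [set T | exists a : X -> R[i]^o, bounded_fun a /\
    forall (f : lp p1 X) (x : X), T f x = a x * f x].

End roe_algebra.

Section coarse_geometry.
Context {R : realType}.

Definition bounded_geometry (X : metricType R) : Prop :=
  forall r : R, 0 <= r -> exists N : nat,
    forall x : X, ([set y | mdist x y <= r] #<= `I_N)%card.

Definition uniformly_expansive (X Y : metricType R) (f : X -> Y) : Prop :=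
  forall r : R, 0 < r -> exists2 s : R, 0 < s &
    forall x1 x2, mdist x1 x2 <= r -> mdist (f x1) (f x2) <= s.

Definition close_maps (T : Type) (Y : metricType R) (f g : T -> Y) : Prop :=
  exists2 c : R, 0 < c & forall x, mdist (f x) (g x) <= c.

Definition coarse_equivalence (X Y : metricType R) (f : X -> Y) : Prop :=
  uniformly_expansive f /\
  exists g : Y -> X, [/\ uniformly_expansive g,
    close_maps (f \o g) idfun & close_maps (g \o f) idfun].

Definition bijectively_coarsely_equivalent (X Y : metricType R) : Prop :=
  exists f : X -> Y, bijective f /\ coarse_equivalence f.

End coarse_geometry.

Arguments uniform_roe {R p} p1 X.
Arguments linfty {R p} p1 X.

(* Main.v *)
Require Import Defs.
From mathcomp Require Import all_boot all_order all_algebra.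
From mathcomp Require Import complex.
From mathcomp Require Import all_classical all_reals all_analysis.
From mathcomp Require Import ring lra.
Set Implicit Arguments.
Unset Strict Implicit.
Unset Printing Implicit Defensive.
Import Order.TTheory GRing.Theory Num.Theory.
Import numFieldNormedType.Exports.
Import ComplexField.
Local Open Scope classical_set_scope.
Local Open Scope ring_scope.
Local Open Scope complex_scope.

(** (1) => (2) is conjugation by the permutation operator of the bijection.

    (4) => (5): for p <> 2 the equality case of Clarkson's inequality shows that
    a linear isometry of l^p preserves disjointness of supports, so its matrix
    has at most one nonzero entry in each row (Lamperti).  A real function of
    sup norm at most 1/2 is the real part of a unimodular function u with
    |u - i| < 1.  If phi is an isometric isomorphism, phi(u) is an isometry at
    distance < 1 from the scalar i; hence its diagonal entries do not vanish
    and phi(u) is diagonal.  These u and their conjugates span l^oo.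

    (5) => (1): phi maps the minimal idempotents of l^oo(X) to those of
    l^oo(Y), which yields a bijection f.  If T is the 0/1 matrix of the
    relation d(x, x') <= r, bounded by bounded geometry, then the entry of
    phi(T) at (f x, f x') has modulus 1 whenever d(x, x') <= r; approximating
    phi(T) by an operator of finite propagation s gives d(f x, f x') <= s. *)

Local Notation normc := Normc.normc.

(** * Moduli of complex numbers, linear maps and real-valued norms *)

Section complex_modulus.
Context {R : realType}.
Implicit Types z : R[i].

Lemma normc_ge0 z : 0 <= normc z.
Proof. by case: z => x y; exact: sqrtr_ge0. Qed.

Lemma normc_gt0 z : z != 0 -> 0 < normc z.
Proof.
move=> z0; rewrite lt_neqAle normc_ge0 andbT eq_sym.
by apply: contra_neq z0 => /Normc.eq0_normc.
Qed.

Lemma normc_real (x : R) : normc (x%:C) = `|x|.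
Proof. by rewrite /= expr0n addr0 sqrtr_sqr. Qed.

Lemma normc_sqr z : normc z ^+ 2 = complex.Re z ^+ 2 + complex.Im z ^+ 2.
Proof. by case: z => x y /=; rewrite sqr_sqrtr// addr_ge0// sqr_ge0. Qed.

Lemma normc_parallelogram (a b : R[i]) :
  normc (a + b) ^+ 2 + normc (a - b) ^+ 2 = 2 * (normc a ^+ 2 + normc b ^+ 2).
Proof. by rewrite !normc_sqr; case: a b => [x y] [u v] /=; ring. Qed.

End complex_modulus.

Section linear_maps.
Context {R : realType} {V W : normedModType R[i]} (T : V -> W).
Hypothesis linT : linear T.

Lemma linear_map0 : T 0 = 0.
Proof. by have := linT (-1) 0 0; rewrite !scaleN1r !addNr. Qed.

Lemma linear_mapD u v : T (u + v) = T u + T v.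
Proof. by have := linT 1 u v; rewrite !scale1r. Qed.

Lemma linear_mapZ c v : T (c *: v) = c *: T v.
Proof. by have := linT c v 0; rewrite linear_map0 !addr0. Qed.

Lemma linear_mapB u v : T (u - v) = T u - T v.
Proof. by rewrite linear_mapD -scaleN1r linear_mapZ scaleN1r. Qed.

End linear_maps.

Section real_norm.
Context {R : realType} {V : normedModType R[i]}.
Implicit Types u v : V.

Definition rnorm v : R := complex.Re `|v|.

Lemma rnormE v : `|v| = (rnorm v)%:C.
Proof. by rewrite /rnorm RRe_real// normr_real. Qed.

Lemma rnorm_ge0 v : 0 <= rnorm v.
Proof. by rewrite -lecR -rnormE normr_ge0. Qed.

Lemma rnormD u v : rnorm (u + v) <= rnorm u + rnorm v.
Proof. by rewrite -lecR rmorphD/= -!rnormE ler_normD. Qed.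

Lemma rnormZ (c : R[i]) v : rnorm (c *: v) = normc c * rnorm v.
Proof.
by apply: complexI; rewrite -rnormE normrZ rnormE rmorphM.
Qed.

Lemma rnorm0 : rnorm (0 : V) = 0.
Proof. by rewrite /rnorm normr0. Qed.

Lemma rnorm_eq0 v : rnorm v = 0 -> v = 0.
Proof. by move=> v0; apply/normr0_eq0; rewrite rnormE v0. Qed.

End real_norm.

(** * Bounded operators and the operator norm *)

Section operator_norm.
Context {R : realType} {V : normedModType R[i]}.
Implicit Types (T S : V -> V) (v : V) (M : R).

Lemma bounded_operatorP T : bounded_operator T <->
  linear T /\ exists2 M : R, 0 <= M & forall v, rnorm (T v) <= M * rnorm v.
Proof.
split=> -[linT].
  (* On the zero space a bound may be negative, hence the maximum with [0]. *)
  move=> [M TM]; split=> //; exists (Num.max 0 M); first by rewrite le_max lexx.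
  move=> v; apply: (@le_trans _ _ (M * rnorm v)).
    by rewrite -lecR rmorphM/= -!rnormE.
  by rewrite ler_wpM2r ?rnorm_ge0// le_max lexx orbT.
move=> [M _ TM]; split=> //; exists M => v.
by rewrite !rnormE -rmorphM lecR.
Qed.

Lemma bounded_linear T : bounded_operator T -> linear T.
Proof. by case. Qed.

Lemma opnorm_le T M : 0 <= M -> (forall v, rnorm (T v) <= M * rnorm v) ->
  opnorm T <= M.
Proof.
move=> M0 TM; apply: ge_sup.
  by exists (rnorm (T 0)); exists 0 => //=; rewrite normr0 ler01.
move=> _ [v /= v1 <-]; apply: le_trans (TM v) _.
by rewrite ler_piMr// -lecR -rnormE.
Qed.

Lemma le_opnorm T v : bounded_operator T -> rnorm (T v) <= opnorm T * rnorm v.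
Proof.
move=> /bounded_operatorP[linT [M M0 TM]].
have [v0|v0] := eqVneq (rnorm v) 0.
  by rewrite (rnorm_eq0 v0) linear_map0// rnorm0 mulr0.
have vp : 0 < rnorm v by rewrite lt_neqAle eq_sym v0 rnorm_ge0.
rewrite -ler_pdivrMr//; apply: ub_le_sup.
  exists M => _ [w /= w1 <-]; apply: le_trans (TM w) _.
  by rewrite ler_piMr// -lecR -rnormE.
exists ((rnorm v)^-1%:C *: v).
  rewrite /= rnormE rnormZ normc_real ger0_norm ?invr_ge0 ?rnorm_ge0//.
  by rewrite mulVf// lexx.
rewrite (linear_mapZ linT) -[LHS]/(rnorm _) rnormZ normc_real ger0_norm ?invr_ge0 ?rnorm_ge0//.
by rewrite mulrC.
Qed.

Lemma opnorm_ge0 T : bounded_operator T -> 0 <= opnorm T.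
Proof.
move=> /[dup] bT /bounded_operatorP[linT [M M0 TM]]; apply: ub_le_sup.
  exists M => _ [w /= w1 <-]; apply: le_trans (TM w) _.
  by rewrite ler_piMr// -lecR -rnormE.
by exists 0 => /=; [rewrite normr0 ler01|rewrite linear_map0// normr0].
Qed.

Lemma bounded_operator_comp S T : bounded_operator S -> bounded_operator T ->
  bounded_operator (S \o T).
Proof.
move=> /bounded_operatorP[linS [M M0 SM]] /bounded_operatorP[linT [N N0 TN]].
apply/bounded_operatorP; split; first by move=> c u v /=; rewrite linT linS.
exists (M * N); rewrite ?mulr_ge0// => v /=.
by apply: le_trans (SM _) _; rewrite -mulrA ler_wpM2l.
Qed.

Lemma bounded_operator_lin (c : R[i]) S T :
  bounded_operator S -> bounded_operator T -> bounded_operator (c *: S + T).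
Proof.
move=> /bounded_operatorP[linS [M M0 SM]] /bounded_operatorP[linT [N N0 TN]].
apply/bounded_operatorP; split.
  move=> a u v; rewrite !fctE linS linT !scalerDr !scalerA.
  by rewrite [c * a]mulrC addrACA.
exists (normc c * M + N); first by rewrite addr_ge0 ?mulr_ge0 ?normc_ge0.
move=> v; rewrite !fctE (le_trans (rnormD _ _))// rnormZ mulrDl.
by rewrite lerD// -mulrA ler_wpM2l ?normc_ge0.
Qed.

Lemma bounded_operator_id : bounded_operator (id : V -> V).
Proof.
by apply/bounded_operatorP; split=> //; exists 1 => // v; rewrite mul1r.
Qed.

Lemma bounded_operatorB S T :
  bounded_operator S -> bounded_operator T -> bounded_operator (S - T).
Proof.
by move=> bS bT; rewrite -scaleN1r addrC; exact: bounded_operator_lin.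
Qed.

Lemma opnormD S T : bounded_operator S -> bounded_operator T ->
  opnorm (S + T) <= opnorm S + opnorm T.
Proof.
move=> bS bT; apply: opnorm_le; first by rewrite addr_ge0 ?opnorm_ge0.
by move=> v; rewrite fctE (le_trans (rnormD _ _))// mulrDl lerD ?le_opnorm.
Qed.

Lemma opnormZ_le (c : R[i]) T : bounded_operator T ->
  opnorm (c *: T) <= normc c * opnorm T.
Proof.
move=> bT; apply: opnorm_le; first by rewrite mulr_ge0 ?normc_ge0 ?opnorm_ge0.
by move=> v; rewrite fctE rnormZ -mulrA ler_wpM2l ?normc_ge0 ?le_opnorm.
Qed.

Lemma opnorm_comp S T : bounded_operator S -> bounded_operator T ->
  opnorm (S \o T) <= opnorm S * opnorm T.
Proof.
move=> bS bT; apply: opnorm_le; first by rewrite mulr_ge0 ?opnorm_ge0.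
move=> v /=; apply: le_trans (le_opnorm _ bS) _.
by rewrite -mulrA ler_wpM2l ?opnorm_ge0 ?le_opnorm.
Qed.

End operator_norm.

(** * Algebras of operators, their norm closures and their isomorphisms *)

Section operator_algebras.
Context {R : realType}.
Implicit Types V W : normedModType R[i].

(** A unital subalgebra of the bounded operators. The single linear clause also yields scalar
    multiples, since [c *: S = (c - 1) *: S + S]. *)
Definition operator_algebra V (A : set (V -> V)) : Prop :=
  [/\ A `<=` @bounded_operator R V, A id,
      forall (c : R[i]) S T, A S -> A T -> A (c *: S + T) &
      forall S T, A S -> A T -> A (S \o T)].

Lemma opnorm_closure_sub V (A : set (V -> V)) :
  A `<=` @bounded_operator R V -> A `<=` opnorm_closure A.
Proof.
move=> bA T AT; split; first exact: bA.
move=> e e0; exists T => //; rewrite subrr; apply: le_lt_trans e0.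
by apply: opnorm_le => // v; rewrite mul0r rnorm0.
Qed.

(** Combinations and products of approximants approximate those of the limits. For products the
    error splits as S(T - T') + (S - S')T'. *)
Lemma opnorm_closure_algebra V (A : set (V -> V)) :
  operator_algebra A -> operator_algebra (opnorm_closure A).
Proof.
move=> [bA A1 linA compA]; split.
- by move=> T [].
- exact: opnorm_closure_sub.
- move=> c S T [bS clS] [bT clT]; split; first exact: bounded_operator_lin.
  move=> e e0; have e2 : 0 < e / 2 by rewrite divr_gt0.
  (* Adding [1] keeps the divisor positive when [c = 0]. *)
  have c0 : 0 < normc c + 1 by rewrite ltr_wpDl ?normc_ge0.
  have [S' AS' SS'] := clS (e / 2 / (normc c + 1)) (divr_gt0 e2 c0).
  have [T' AT' TT'] := clT (e / 2) e2.
  exists (c *: S' + T'); first exact: linA.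
  have -> : c *: S + T - (c *: S' + T') = c *: (S - S') + (T - T').
    by rewrite scalerBr opprD addrACA.
  have bSS' : bounded_operator (S - S') by apply: bounded_operatorB => //; exact: bA.
  have bTT' : bounded_operator (T - T') by apply: bounded_operatorB => //; exact: bA.
  have bcSS' : bounded_operator (c *: (S - S')).
    rewrite -[_ *: _]addr0 -[0](subrr S); apply: bounded_operator_lin => //.
    exact: bounded_operatorB.
  apply: le_lt_trans (opnormD bcSS' bTT') _.
  rewrite [e]splitr ler_ltD//; apply: le_trans (opnormZ_le _ bSS') _.
  apply: (@le_trans _ _ ((normc c + 1) * opnorm (S - S'))).
    by rewrite ler_wpM2r ?opnorm_ge0// lerDl.
  by rewrite mulrC -ler_pdivlMr// ltW.
- move=> S T [bS clS] [bT clT]; split; first exact: bounded_operator_comp.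
  move=> e e0; have e2 : 0 < e / 2 by rewrite divr_gt0.
  have c0 : 0 < opnorm S + 1 by rewrite ltr_wpDl ?opnorm_ge0.
  have [T' AT' TT'] := clT (e / 2 / (opnorm S + 1)) (divr_gt0 e2 c0).
  have d0 : 0 < opnorm T' + 1 by rewrite ltr_wpDl ?opnorm_ge0//; exact: bA.
  (* [S'] is chosen after [T'], because its tolerance depends on the norm of [T']. *)
  have [S' AS' SS'] := clS (e / 2 / (opnorm T' + 1)) (divr_gt0 e2 d0).
  exists (S' \o T'); first exact: compA.
  have -> : (S \o T) - (S' \o T') = (S \o (T - T')) + ((S - S') \o T').
    apply/funext => v.
    rewrite -[RHS]/(S (T v - T' v) + (S (T' v) - S' (T' v))).
    by rewrite (linear_mapB (bounded_linear bS)) addrA subrK.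
  have bSS' : bounded_operator (S - S') by apply: bounded_operatorB => //; exact: bA.
  have bTT' : bounded_operator (T - T') by apply: bounded_operatorB => //; exact: bA.
  have bT' := bA _ AT'.
  apply: le_lt_trans (opnormD (bounded_operator_comp bS bTT') (bounded_operator_comp bSS' bT')) _.
  rewrite [e]splitr ltr_leD//.
    apply: le_lt_trans (opnorm_comp bS bTT') _.
    apply: (@le_lt_trans _ _ ((opnorm S + 1) * opnorm (T - T'))).
      by rewrite ler_wpM2r ?opnorm_ge0// lerDl.
    by rewrite mulrC -ltr_pdivlMr.
  apply: le_trans (opnorm_comp bSS' bT') _.
  apply: (@le_trans _ _ (opnorm (S - S') * (opnorm T' + 1))).
    by rewrite ler_wpM2l ?opnorm_ge0// lerDl.
  by rewrite -ler_pdivlMr// ltW.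
Qed.

(** This symmetry allows inclusions and expansiveness to be proved for one direction and then
    applied to both [phi] and its inverse. *)
Lemma isometric_isomorphism_inv V W (A : set (V -> V)) (B : set (W -> W)) phi :
  operator_algebra A -> isometric_isomorphism A B phi ->
  exists psi, [/\ isometric_isomorphism B A psi,
    {in A, cancel phi psi} & {in B, cancel psi phi}].
Proof.
move=> [bA A1 linA compA] [[AB injphi surphi] linphi compphi isophi].
have /choice[psi psiP] : forall T, exists S, B T -> A S /\ phi S = T.
  (* The inverse is constrained on [B] only, so any value will do elsewhere. *)
  move=> T; have [BT|] := pselect (B T); last by exists id.
  by have [S AS ST] := surphi _ BT; exists S.
have psiK S : A S -> psi (phi S) = S.
  move=> AS; have [|AS' /injphi] := psiP (phi S); first exact: AB.
  by apply; rewrite inE.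
have BA T : B T -> A (psi T) by move=> /psiP[].
have phiK T : B T -> phi (psi T) = T by move=> /psiP[].
exists psi; split; last 2 first.
- by move=> S /[1!inE]; exact: psiK.
- by move=> T /[1!inE]; exact: phiK.
split.
- split => //; first by move=> S T /[!inE] /phiK {2}<- /phiK {2}<- ->.
  by move=> S AS; exists (phi S); [exact: AB|exact: psiK].
- move=> c S T BS BT; have AS := BA _ BS; have AT := BA _ BT.
  by rewrite -(psiK (c *: psi S + psi T)) ?linphi ?phiK//; exact: linA.
- move=> S T BS BT; have AS := BA _ BS; have AT := BA _ BT.
  rewrite -[RHS]psiK; last exact: compA.
  by rewrite (compphi _ _ AS AT) phiK// phiK.
- by move=> T BT; rewrite -isophi ?phiK//; exact: BA.
Qed.

End operator_algebras.

(** * Clarkson's inequality for two complex numbers, with its strict cases *)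

Section powers.
Context {R : realType}.
Implicit Types (p q s t A B : R) (a b : R[i]).

(** Write each power as C^q = C C^(q-1); the factor (A + B)^(q-1) strictly exceeds both A^(q-1) and
    B^(q-1). *)
Lemma powR_superadditive q A B : 1 < q -> 0 < A -> 0 < B ->
  A `^ q + B `^ q < (A + B) `^ q.
Proof.
move=> q1 A0 B0; have AB0 : 0 < A + B by rewrite addr_gt0.
have q0 : 0 < q - 1 by rewrite subr_gt0.
have powS C : 0 < C -> C `^ q = C * C `^ (q - 1).
  by move=> C0; rewrite mulr_powRB1 ?ltW// (lt_trans _ q1).
rewrite !powS// mulrDl ltrD// ltr_pM2l// gt0_ltr_powR// ?nnegrE ?ltW//.
- by rewrite ltrDl.
- by rewrite ltrDr.
Qed.

(** Superadditivity for the exponent 1/q, applied to A^q and B^q. *)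
Lemma powR_subadditive q A B : 0 < q < 1 -> 0 < A -> 0 < B ->
  (A + B) `^ q < A `^ q + B `^ q.
Proof.
move=> /andP[q0 q1] A0 B0; have q'1 : 1 < q^-1 by rewrite invf_gt1.
have := powR_superadditive q'1 (powR_gt0 q A0) (powR_gt0 q B0).
rewrite -!powRrM mulfV ?gt_eqF// !powRr1 ?ltW//.
move=> /(gt0_ltr_powR q0); rewrite -powRrM mulVf ?gt_eqF// powRr1.
  by apply; rewrite nnegrE ?powR_ge0// addr_ge0// ltW.
by rewrite addr_ge0// powR_ge0.
Qed.

Lemma powR_midpoint q s t : 1 <= q -> 0 <= s -> 0 <= t ->
  2 * ((s + t) / 2) `^ q <= s `^ q + t `^ q.
Proof.
move=> q1 s0 t0.
have h0 : 0 <= 2^-1 :> R by rewrite invr_ge0.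
have h1 : 2^-1 <= 1 :> R by rewrite invf_le1// ler1n.
have : (2^-1 * s + (1 - 2^-1) * t) `^ q <= 2^-1 * s `^ q + (1 - 2^-1) * t `^ q.
  have := @convex_powR R q q1 (Itv01 h0 h1) s t.
  by rewrite !inE/= !in_itv/= !andbT => /(_ s0 t0); rewrite !convRE.
have -> : 1 - 2^-1 = 2^-1 :> R by lra.
rewrite -!mulrDr [2^-1 * (s + t)]mulrC => le2.
by rewrite -ler_pdivlMl.
Qed.

(** Midpoint convexity for the exponent 1/q, applied to s^q and t^q. *)
Lemma powR_midpoint_concave q s t : 0 < q <= 1 -> 0 <= s -> 0 <= t ->
  s `^ q + t `^ q <= 2 * ((s + t) / 2) `^ q.
Proof.
move=> /andP[q0 q1] s0 t0; have q'1 : 1 <= q^-1 by rewrite invf_ge1.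
have := powR_midpoint q'1 (powR_ge0 s q) (powR_ge0 t q).
rewrite -!powRrM mulfV ?gt_eqF// !powRr1// mulrC -ler_pdivlMr//.
set u := (_ + _) / 2 => ust.
have u0 : 0 <= u by rewrite divr_ge0// addr_ge0// powR_ge0.
have : (u `^ q^-1) `^ q <= ((s + t) / 2) `^ q.
  by rewrite ge0_ler_powR ?nnegrE ?powR_ge0 ?(ltW q0)// divr_ge0// addr_ge0.
rewrite -powRrM mulVf ?gt_eqF// powRr1// /u ler_pdivrMr// => /le_trans; apply.
by rewrite mulrC.
Qed.

Let normc_powE p a : normc a `^ p = (normc a ^+ 2) `^ (p / 2).
Proof.
rewrite -powR_mulrn ?normc_ge0// -powRrM; congr (_ `^ _).
by rewrite mulrC divfK// pnatr_eq0.
Qed.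

(** The defect in the parallelogram law with exponent [p]; it vanishes identically at [p = 2]. *)
Definition clarkson_gap p a b : R :=
  normc (a + b) `^ p + normc (a - b) `^ p - 2 * (normc a `^ p + normc b `^ p).

Let gap_mean a b : (normc (a + b) ^+ 2 + normc (a - b) ^+ 2) / 2 =
  normc a ^+ 2 + normc b ^+ 2.
Proof. by rewrite normc_parallelogram mulrC mulKf// pnatr_eq0. Qed.

(** Put q = p/2 > 1. Midpoint convexity at the squares of |a + b| and |a - b|, together with the
    parallelogram law, bounds the first two terms below by 2(|a|^2 + |b|^2)^q. Strict
    superadditivity then concludes. For p < 2 both inequalities are reversed. *)
Lemma clarkson_gap_gt0 p a b : 2 < p -> a != 0 -> b != 0 -> 0 < clarkson_gap p a b.
Proof.
move=> p2 a0 b0; have q1 : 1 < p / 2 by rewrite ltr_pdivlMr// mul1r.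
have sq0 (c : R[i]) : c != 0 -> 0 < normc c ^+ 2.
  by move=> c0; exact/exprn_gt0/normc_gt0.
rewrite subr_gt0 !(normc_powE p).
apply: lt_le_trans (powR_midpoint (ltW q1) (sqr_ge0 _) (sqr_ge0 _)).
by rewrite gap_mean ltr_pM2l// powR_superadditive ?sq0.
Qed.

Lemma clarkson_gap_lt0 p a b : 0 < p < 2 -> a != 0 -> b != 0 ->
  clarkson_gap p a b < 0.
Proof.
move=> /andP[p0 p2] a0 b0.
have q0 : 0 < p / 2 by rewrite divr_gt0.
have q1 : p / 2 < 1 by rewrite ltr_pdivrMr// mul1r.
have sq0 (c : R[i]) : c != 0 -> 0 < normc c ^+ 2.
  by move=> c0; exact/exprn_gt0/normc_gt0.
rewrite subr_lt0 !(normc_powE p).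
have q01 : 0 < p / 2 <= 1 by rewrite q0 ltW.
apply: le_lt_trans (powR_midpoint_concave q01 (sqr_ge0 _) (sqr_ge0 _)) _.
by rewrite gap_mean ltr_pM2l// powR_subadditive ?sq0// q0.
Qed.

Lemma clarkson_gap_eq0 p a b : 0 < p -> (a == 0) || (b == 0) ->
  clarkson_gap p a b = 0.
Proof.
move=> p0 /orP[] /eqP->; rewrite /clarkson_gap.
  by rewrite add0r sub0r normcN Normc.normc0 powR0 ?gt_eqF//; ring.
by rewrite addr0 subr0 Normc.normc0 powR0 ?gt_eqF//; ring.
Qed.

End powers.

Section esum_equality.
Context {R : realType} {T : choiceType}.

(** The sum of [v] is the sum of [u] plus that of the nonnegative [v - u]. Finiteness allows
    cancellation, so the last sum is zero and each of its terms vanishes. *)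
Lemma esum_eq_pointwise (u v : T -> R) :
  (forall x, 0 <= u x <= v x) ->
  (\esum_(x in [set: T]) (v x)%:E < +oo)%E ->
  (\esum_(x in [set: T]) (u x)%:E = \esum_(x in [set: T]) (v x)%:E)%E ->
  forall x, u x = v x.
Proof.
move=> uv vfin uvE x.
have d0 y : 0 <= v y - u y by rewrite subr_ge0; case/andP: (uv y).
have u0 y : 0 <= u y by case/andP: (uv y).
have : (\esum_(y in [set: T]) (v y)%:E =
    \esum_(y in [set: T]) (u y)%:E + \esum_(y in [set: T]) (v y - u y)%:E)%E.
  rewrite -esumD; last 2 first.
  - by move=> y _; rewrite lee_fin.
  - by move=> y _; rewrite lee_fin.
  by apply: eq_esum => y _; rewrite -EFinD subrKC.
rewrite uvE; set S := esum _ _ => SE.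
have S0 : (0 <= S)%E.
  by rewrite /S -uvE; apply: esum_ge0 => y _; rewrite lee_fin.
have Sfin : S \is a fin_num by rewrite ge0_fin_numE.
have D0 : (\esum_(y in [set: T]) (v y - u y)%:E = 0)%E.
  set D := esum _ _ in SE *.
  by rewrite -[D](@addeK _ S)// [(D + S)%E]addeC -SE subee.
have : ((v x - u x)%:E <= 0)%E.
  rewrite -D0; apply: esum_ge; exists [set x]; first by split.
  by rewrite fsbig_set1.
by rewrite lee_fin subr_le0 => vu; apply/le_anti; rewrite vu; case/andP: (uv x) => _ ->.
Qed.

End esum_equality.

(** * Vectors of [lp], their coordinates, and matrix entries of operators *)

Section lp_vectors.
Context {R : realType} {p : R} {p1 : 1 <= p} {X : choiceType}.
Implicit Types (f g : lp p1 X) (x y z : X) (M : R).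

Let p0 : 0 < p. Proof. exact: lt_le_trans p1. Qed.

Lemma lp_ext f g : (forall x, f x = g x) -> f = g.
Proof. by move=> fg; apply/val_inj/funext. Qed.

Lemma lp_addE f g x : (f + g) x = f x + g x. Proof. by []. Qed.

Lemma lp_oppE f x : (- f) x = - f x. Proof. by []. Qed.

Lemma lp_scaleE (c : R[i]) f x : (c *: f) x = c * f x. Proof. by []. Qed.

Lemma lp_sum_rnorm f : lp_sum p f = (rnorm f `^ p)%:E.
Proof. by rewrite (lp_normfP p1 (lpP f)). Qed.

Lemma rnorm_le f M : 0 <= M -> (lp_sum p f <= (M `^ p)%:E)%E -> rnorm f <= M.
Proof. exact: lp_normf_le. Qed.

Lemma lp_sum_entry f x : ((normc (f x) `^ p)%:E <= lp_sum p f)%E.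
Proof. by apply: esum_ge; exists [set x]; [split|rewrite fsbig_set1]. Qed.

Lemma powR_le_inv (a b : R) : 0 <= a -> 0 <= b -> a `^ p <= b `^ p -> a <= b.
Proof.
move=> a0 b0; apply: contraTT; rewrite -!ltNge => ba.
by rewrite gt0_ltr_powR// ?nnegrE ?ltW.
Qed.

Lemma normc_entry f x : normc (f x) <= rnorm f.
Proof.
apply: powR_le_inv; rewrite ?normc_ge0 ?rnorm_ge0//.
by rewrite -lee_fin -lp_sum_rnorm lp_sum_entry.
Qed.

Lemma deltaE x y : delta p1 y x = (x == y)%:R.
Proof. by []. Qed.

Lemma rnorm_delta y : rnorm (delta p1 y) = 1.
Proof.
apply/eqP; rewrite eq_le; apply/andP; split; last first.
  by have := normc_entry (delta p1 y) y; rewrite deltaE eqxx Normc.normc1.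
apply: rnorm_le => //; rewrite powR1.
rewrite /lp_sum (esumID [set y])//=; last by move=> x _; rewrite lee_fin powR_ge0.
rewrite !setTI [X in (_ + X)%E]esum1 => [|x /= xy].
  rewrite esum_set1; last by rewrite lee_fin powR_ge0.
  rewrite adde0 /delta_fun eqxx.
  by rewrite [normc _]Normc.normc1 powR1.
by rewrite /delta_fun; case: eqP => // _; rewrite [normc _]Normc.normc0 powR0 ?gt_eqF.
Qed.

Lemma sum_deltaE (c : X -> R[i]) (s : seq X) x : uniq s ->
  (\sum_(z <- s) c z *: delta p1 z) x = if x \in s then c x else 0.
Proof.
elim: s => [|z s IH] /=; first by rewrite big_nil.
move=> /andP[zs us]; rewrite big_cons lp_addE lp_scaleE deltaE IH// inE.
have [->|xz] := eqVneq x z; first by rewrite (negPf zs) mulr1 addr0.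
by rewrite mulr0 add0r.
Qed.

(** The sum defining the norm is a supremum over finite sets, so some finite [F] leaves a tail of at
    most (e/2)^p. *)
Lemma finite_support_dense f (e : R) : 0 < e ->
  exists2 s : seq X, uniq s & rnorm (f - \sum_(z <- s) f z *: delta p1 z) < e.
Proof.
move=> e0; have e2 : 0 < e / 2 by rewrite divr_gt0.
pose u x : \bar R := (normc (f x) `^ p)%:E.
have u0 x : (0 <= u x)%E by rewrite lee_fin powR_ge0.
have ffin : lp_sum p f \is a fin_num by rewrite ge0_fin_numE ?lp_sum_ge0// lpP.
have ep0 : (0 < ((e / 2) `^ p)%:E)%E by rewrite lte_fin powR_gt0.
have [_ [F [finF _] <-] FE] := ub_ereal_sup_adherent ep0 ffin.
exists (finmap.enum_fset (fset_set F)); first exact: finmap.fset_uniq.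
(* [rnorm_le] gives a non-strict bound; halving [e] makes it strict. *)
apply: (@le_lt_trans _ _ (e / 2)); last by rewrite ltr_pdivrMr// mulr_natr mulr2n ltrDr.
apply: rnorm_le; first exact: ltW.
have -> : lp_sum p (f - \sum_(z <- finmap.enum_fset (fset_set F)) f z *: delta p1 z) =
    (\esum_(x in ~` F) u x)%E.
  rewrite esum_mkcond; apply: eq_esum => x _.
  rewrite lp_addE lp_oppE sum_deltaE ?finmap.fset_uniq// in_fset_set// in_setC.
  case: (x \in F) => /=; last by rewrite subr0.
  by rewrite subrr [normc _]Normc.normc0 powR0 ?gt_eqF.
have fE : (lp_sum p f = \esum_(x in F) u x + \esum_(x in ~` F) u x)%E.
  by rewrite /lp_sum (esumID F) ?setTI// => x _; exact: u0.
have Ffin : (\esum_(x in F) u x)%E \is a fin_num.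
  rewrite ge0_fin_numE ?esum_ge0//; apply: le_lt_trans (lpP f).
  by rewrite fE leeDl// esum_ge0.
have FsE : (\esum_(x in F) u x = \sum_(x \in F) u x)%E.
  by rewrite -esum_fset//; congr esum; apply/seteqP; split => x /=; rewrite inE.
move: FE; rewrite -/(esum _ _) -/(lp_sum p f) fE -FsE.
rewrite lteBlDr// lteD2lE//.
by move/ltW.
Qed.

End lp_vectors.

Section matrix_entries.
Context {R : realType} {p : R} {p1 : 1 <= p} {X : choiceType}.
Implicit Types (T S : lp p1 X -> lp p1 X) (f g : lp p1 X) (x y z : X).

Lemma matrix_entry_le T x y : bounded_operator T ->
  normc (matrix_entry T x y) <= opnorm T.
Proof.
move=> bT; apply: le_trans (normc_entry _ _) _.
by have := le_opnorm (delta p1 y) bT; rewrite rnorm_delta mulr1.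
Qed.

(* Finitely supported vectors are dense. *)
Lemma bounded_operator_eq0_at T g x : bounded_operator T ->
  (forall z, g z != 0 -> matrix_entry T x z = 0) -> T g x = 0.
Proof.
move=> bT gT; apply: Normc.eq0_normc; apply/eqP; rewrite eq_le normc_ge0 andbT.
apply/ler_addgt0Pl => e e0; rewrite addr0.
have M0 : 0 < opnorm T + 1 by rewrite ltr_wpDl// opnorm_ge0.
have [s us gs] := finite_support_dense g (divr_gt0 e0 M0).
set h := \sum_(z <- s) _ in gs.
have linT := bounded_linear bT.
have Th0 : T h x = 0.
  rewrite /h; elim: s {us gs h} => [|z s IH]; first by rewrite big_nil linear_map0.
  rewrite big_cons linT lp_addE IH addr0 lp_scaleE.
  by have [->|/gT gz] := eqVneq (g z) 0; [rewrite mul0r|rewrite [T _ _]gz mulr0].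
have -> : T g x = T (g - h) x.
  by rewrite (linear_mapB linT) lp_addE lp_oppE Th0 subr0.
apply: le_trans (normc_entry _ _) _; apply: le_trans (le_opnorm _ bT) _.
apply: (@le_trans _ _ ((opnorm T + 1) * rnorm (g - h))).
  by rewrite ler_wpM2r ?rnorm_ge0// lerDl.
by rewrite mulrC -ler_pdivlMr// ltW.
Qed.

(** The trace left on supports by the matrix product, obtained without an infinite sum: otherwise
    the column [T (delta p1 y)] would live where row [x] of [S] vanishes. *)
Lemma matrix_entry_comp_neq0 S T x y : bounded_operator S ->
  matrix_entry (S \o T) x y != 0 ->
  exists z, matrix_entry S x z != 0 /\ matrix_entry T z y != 0.
Proof.
move=> bS ST0; apply: contrapT => /forallNP ST; move/eqP: ST0; apply.
rewrite -[LHS]/(S (T (delta p1 y)) x).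
apply: (bounded_operator_eq0_at bS) => z Tzy.
by apply/eqP/negPn/negP => Sxz; exact: (ST z).
Qed.

(** The vector [f - f x *: delta p1 x] vanishes at [x], the only place where row [x] of [T] may be
    nonzero. *)
Lemma diagonal_operatorE T : bounded_operator T ->
  (forall x y, x != y -> matrix_entry T x y = 0) ->
  forall f x, T f x = matrix_entry T x x * f x.
Proof.
move=> bT T0 f x; have linT := bounded_linear bT.
have : T (f - f x *: delta p1 x) x = 0.
  apply: bounded_operator_eq0_at => // z.
  rewrite lp_addE lp_oppE lp_scaleE deltaE.
  have [->|zx _] := eqVneq z x; first by rewrite mulr1 subrr eqxx.
  by rewrite T0// eq_sym.
rewrite (linear_mapB linT) (linear_mapZ linT) lp_addE lp_oppE lp_scaleE.
by move=> /eqP; rewrite subr_eq0 => /eqP ->; rewrite mulrC.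
Qed.

End matrix_entries.

(** * Multiplication operators *)

Section lp_from_functions.
Context {R : realType} {p : R} {p1 : 1 <= p}.

(** Total by convention: a function that is not p-summable is sent to [0]. Operators can thus be
    defined by a formula before summability is proved. *)
Definition lp_of {X : choiceType} (f : X -> R[i]^o) : lp p1 X := insubd 0 f.

Lemma lp_ofE (X : choiceType) (f : X -> R[i]^o) :
  (lp_sum p f < +oo)%E -> lp_of f = f :> (X -> R[i]).
Proof.
move=> fp; have fin : f \in @lp_pred R p X by rewrite inE.
by have := insubdK (0 : lp p1 X) fin.
Qed.

Definition mul_operator {X : choiceType} (a : X -> R[i]^o) (f : lp p1 X) : lp p1 X :=
  lp_of (fun x => a x * f x).

Context {X : choiceType}.
Implicit Types (a b : X -> R[i]^o) (f : lp p1 X).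

Definition bounded_by (M : R) a := forall x, normc (a x) <= M.

Lemma lp_sum_mul_le a M f : 0 <= M -> bounded_by M a ->
  (lp_sum p (fun x => (a x * f x)%R) <= ((M * rnorm f) `^ p)%:E)%E.
Proof.
move=> M0 aM; rewrite powRM ?rnorm_ge0// EFinM -lp_sum_rnorm /lp_sum.
rewrite -esumZl ?powR_ge0//; last by move=> x; rewrite lee_fin powR_ge0.
apply: le_esum => x _; rewrite -EFinM lee_fin Normc.normcM powRM ?normc_ge0//.
have p0 : 0 <= p by rewrite (le_trans _ p1).
by rewrite ler_wpM2r ?powR_ge0// ge0_ler_powR ?nnegrE ?normc_ge0.
Qed.

Lemma mul_operatorE a M : bounded_by M a ->
  forall f x, mul_operator a f x = a x * f x.
Proof.
move=> aM f x.
(* When [X] is empty, [M] may be negative. *)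
have {}aM : bounded_by (Num.max 0 M) a.
  by move=> y; rewrite le_max aM orbT.
rewrite /mul_operator lp_ofE//; apply: le_lt_trans (ltry _).
by apply: lp_sum_mul_le aM; rewrite le_max lexx.
Qed.

Lemma rnorm_mul_operator a M f : 0 <= M -> bounded_by M a ->
  rnorm (mul_operator a f) <= M * rnorm f.
Proof.
move=> M0 aM; apply: rnorm_le; first by rewrite mulr_ge0 ?rnorm_ge0.
rewrite /lp_sum; under eq_esum do rewrite (mul_operatorE aM).
exact: lp_sum_mul_le.
Qed.

Lemma mul_operator_bounded a M : 0 <= M -> bounded_by M a ->
  bounded_operator (mul_operator a).
Proof.
move=> M0 aM; apply/bounded_operatorP; split.
  move=> c f g; apply: lp_ext => x.
  rewrite lp_addE lp_scaleE !(mul_operatorE aM) lp_addE lp_scaleE.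
  by rewrite mulrDr mulrCA.
by exists M => // f; exact: rnorm_mul_operator.
Qed.

Lemma opnorm_mul_operator a M : 0 <= M -> bounded_by M a ->
  opnorm (mul_operator a) <= M.
Proof. by move=> M0 aM; apply: opnorm_le => // f; exact: rnorm_mul_operator. Qed.

Lemma mul_operator_entry a M x y : bounded_by M a ->
  matrix_entry (mul_operator a) x y = a x * (x == y)%:R.
Proof. by move=> aM; rewrite /matrix_entry (mul_operatorE aM). Qed.

End lp_from_functions.

(** * The uniform Roe algebra and its diagonal subalgebra *)

Section uniform_roe_algebra.
Context {R : realType} {p : R} {p1 : 1 <= p} {X : metricType R}.
Implicit Types (T S : lp p1 X -> lp p1 X) (x y z : X).

Lemma finite_propagationP T : finite_propagation T <-> bounded_operator T /\
  exists2 r : R, 0 < r & forall x y, matrix_entry T x y != 0 -> mdist x y <= r.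
Proof.
split=> -[bT].
  move=> pT; split=> //; have [k kP] : exists k : R, (propagation T <= k%:E)%E.
    (* The value [-oo], taken at the zero matrix, is bounded by [0]. *)
    by case: (propagation T) pT => [k _||] //; [exists k|exists 0; rewrite leNye].
  exists (Num.max 1 k); first by rewrite lt_max ltr01.
  move=> x y Txy; rewrite le_max -[X in _ || X]lee_fin; apply/orP; right.
  by apply: le_trans kP; apply: ereal_sup_ubound; exists x, y.
move=> [r r0 Tr]; split=> //; apply: (@le_lt_trans _ _ r%:E); last exact: ltry.
by apply: ge_ereal_sup => _ [x [y [Txy ->]]]; rewrite lee_fin Tr.
Qed.

(** It suffices to treat operators of finite propagation: bounds on propagation combine by maximum
    under linear combinations and by addition under composition, through the triangle inequality. *)
Lemma uniform_roe_algebra : operator_algebra (uniform_roe p1 X).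
Proof.
apply: opnorm_closure_algebra; split.
- by move=> T [].
- apply/finite_propagationP; split; first exact: bounded_operator_id.
  exists 1 => // x y; rewrite /matrix_entry deltaE.
  have [->|_] := eqVneq x y; last by rewrite eqxx.
  by rewrite mdistxx.
- move=> c S T /finite_propagationP[bS [r r0 Sr]] /finite_propagationP[bT [s s0 Ts]].
  apply/finite_propagationP; split; first exact: bounded_operator_lin.
  exists (Num.max r s); first by rewrite lt_max r0.
  move=> x y STxy; rewrite le_max.
  have [Sxy|/Sr -> //] := eqVneq (matrix_entry S x y) 0.
  have [Txy|/Ts ->] := eqVneq (matrix_entry T x y) 0; last by rewrite orbT.
  move: STxy; rewrite /matrix_entry lp_addE lp_scaleE.
  by rewrite [S _ _]Sxy [T _ _]Txy mulr0 addr0 eqxx.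
- move=> S T /finite_propagationP[bS [r r0 Sr]] /finite_propagationP[bT [s s0 Ts]].
  apply/finite_propagationP; split; first exact: bounded_operator_comp.
  exists (r + s); first by rewrite addr_gt0.
  move=> x y /(matrix_entry_comp_neq0 bS)[z [/Sr xz /Ts zy]].
  by apply: le_trans (metric_triangle x z y) _; exact: lerD.
Qed.

Lemma finite_propagation_roe T : finite_propagation T -> uniform_roe p1 X T.
Proof. by apply: opnorm_closure_sub => S []. Qed.

Lemma uniform_roe_bounded T : uniform_roe p1 X T -> bounded_operator T.
Proof. by case. Qed.

Lemma linftyP T : linfty p1 X T <->
  exists a : X -> R[i]^o, exists M : R,
    [/\ 0 <= M, bounded_by M a & T = mul_operator a].
Proof.
split.
  move=> [a [[K [Kreal KP]] Ta]].
  have /complex_realP[k kE] := Kreal.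
  (* [bounded_fun] grants a bound by every number strictly above [k]; this one is also
     nonnegative. *)
  have ak : bounded_by (`|k| + 1) a.
    move=> x; rewrite -lecR; apply: KP => //.
    by rewrite kE ltcR (le_lt_trans (ler_norm _))// ltrDl.
  exists a, (`|k| + 1); split=> //.
  by apply/funext => f; apply: lp_ext => x; rewrite Ta (mul_operatorE ak).
move=> [a [M [M0 aM ->]]]; exists a; split; last first.
  by move=> f x; rewrite (mul_operatorE aM).
exists M%:C; split; first by apply/complex_realP; exists M.
move=> N MN x _; apply: le_trans (ltW MN).
by rewrite -[leLHS]/(normc (a x))%:C lecR.
Qed.

Lemma mul_operator_linfty (a : X -> R[i]^o) M : 0 <= M -> bounded_by M a ->
  linfty p1 X (mul_operator a).
Proof. by move=> M0 aM; apply/linftyP; exists a, M. Qed.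

Lemma linfty_roe : linfty p1 X `<=` uniform_roe p1 X.
Proof.
move=> _ /linftyP[a [M [M0 aM ->]]]; apply: finite_propagation_roe.
apply/finite_propagationP; split; first exact: mul_operator_bounded aM.
exists 1 => // x y; rewrite (mul_operator_entry _ _ aM).
by have [->|_] := eqVneq x y; [rewrite mdistxx|rewrite mulr0 eqxx].
Qed.

Lemma diagonal_linfty T : bounded_operator T ->
  (forall x y, x != y -> matrix_entry T x y = 0) -> linfty p1 X T.
Proof.
move=> bT T0; have aM : bounded_by (opnorm T) (fun x => matrix_entry T x x).
  by move=> x; exact: matrix_entry_le.
apply/linftyP; exists (fun x => matrix_entry T x x), (opnorm T).
split=> //; first exact: opnorm_ge0.
by apply/funext => f; apply: lp_ext => x; rewrite (mul_operatorE aM) (diagonal_operatorE bT).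
Qed.

End uniform_roe_algebra.

(** * Permutation operators and conjugation by a bijection *)

Section composition_operators.
Context {R : realType} {p : R} {p1 : 1 <= p}.

(** For a bijection [h] with inverse [k], this is the isometric permutation operator that moves the
    basis vector at [x] to the one at [k x]. *)
Definition comp_operator {X Y : choiceType} (h : Y -> X) (f : lp p1 X) : lp p1 Y :=
  lp_of (f \o h).

Context {X Y : choiceType} (h : Y -> X) (k : X -> Y).
Hypotheses (hK : cancel h k) (kK : cancel k h).
Implicit Types (f g : lp p1 X).

Lemma lp_sum_comp (f : X -> R[i]^o) : lp_sum p (f \o h) = lp_sum p f.
Proof.
rewrite [RHS]/lp_sum (reindex_esum [set: Y] _ h)//; split=> //.
  by move=> y y' _ _; exact: can_inj hK _ _.
by move=> x _; exists (k x).
Qed.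

Lemma comp_operatorE f y : comp_operator h f y = f (h y).
Proof. by rewrite /comp_operator lp_ofE// lp_sum_comp lpP. Qed.

Lemma rnorm_comp_operator f : rnorm (comp_operator h f) = rnorm f.
Proof.
rewrite -[LHS]/(lp_normf p _) /lp_normf.
have -> : lp_sum p (comp_operator h f) = lp_sum p f.
  rewrite -lp_sum_comp /lp_sum; apply: eq_esum => y _.
  by rewrite comp_operatorE.
by [].
Qed.

Lemma comp_operator_linear : linear (comp_operator h : lp p1 X -> lp p1 Y).
Proof.
move=> c f g; apply: lp_ext => y; rewrite comp_operatorE !lp_addE !lp_scaleE.
by rewrite comp_operatorE comp_operatorE.
Qed.

Lemma comp_operator_delta x : comp_operator h (delta p1 x) = delta p1 (k x).
Proof.
apply: lp_ext => y; rewrite comp_operatorE !deltaE; congr (_%:R : R[i]); congr nat_of_bool.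
by apply/eqP/eqP => [<-|->].
Qed.

End composition_operators.

Lemma comp_operatorK {R : realType} {p : R} {p1 : 1 <= p} {X Y : choiceType}
    (h : Y -> X) (k : X -> Y) : cancel h k -> cancel k h ->
  cancel (comp_operator h : lp p1 X -> lp p1 Y) (comp_operator k).
Proof.
move=> hK kK f; apply: lp_ext => x.
by rewrite (comp_operatorE kK hK) (comp_operatorE hK kK) kK.
Qed.

Section conjugation.
Context {R : realType} {p : R} {p1 : 1 <= p}.

(** The conjugate U T U^-1 by the permutation operator U of [h], once [h] and [k] are mutually
    inverse. *)
Definition conjugate_operator {X Y : choiceType} (h : Y -> X) (k : X -> Y)
    (T : lp p1 X -> lp p1 X) : lp p1 Y -> lp p1 Y :=
  comp_operator h \o T \o comp_operator k.

Lemma conjugate_operatorK {X Y : choiceType} (h : Y -> X) (k : X -> Y) :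
  cancel h k -> cancel k h ->
  cancel (conjugate_operator h k) (conjugate_operator k h).
Proof.
by move=> hK kK T; apply/funext => f; rewrite /conjugate_operator/= !comp_operatorK.
Qed.

Lemma conjugate_bounded {X Y : choiceType} (h : Y -> X) (k : X -> Y)
    (T : lp p1 X -> lp p1 X) : cancel h k -> cancel k h ->
  bounded_operator T -> bounded_operator (conjugate_operator h k T).
Proof.
move=> hK kK /bounded_operatorP[linT [M M0 TM]]; apply/bounded_operatorP; split.
  by move=> c f g; rewrite /conjugate_operator/= (comp_operator_linear kK hK) linT
    (comp_operator_linear hK kK).
exists M => // f; rewrite /conjugate_operator/= (rnorm_comp_operator hK kK).
by rewrite -[rnorm f](rnorm_comp_operator kK hK).
Qed.

Lemma opnorm_conjugate_le {X Y : choiceType} (h : Y -> X) (k : X -> Y)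
    (T : lp p1 X -> lp p1 X) : cancel h k -> cancel k h ->
  bounded_operator T -> opnorm (conjugate_operator h k T) <= opnorm T.
Proof.
move=> hK kK bT; apply: opnorm_le => [|f]; first exact: opnorm_ge0.
rewrite /conjugate_operator/= (rnorm_comp_operator hK kK).
by rewrite -[rnorm f](rnorm_comp_operator kK hK); exact: le_opnorm.
Qed.

(** The entry of the conjugate at (x, y) is the entry at (h x, h y), so expansiveness of [k] turns
    propagation [r] into propagation [s]. Conjugation does not increase norms, so approximations
    carry over. *)
Lemma conjugate_roe {X Y : metricType R} (h : Y -> X) (k : X -> Y)
    (T : lp p1 X -> lp p1 X) : cancel h k -> cancel k h ->
  uniformly_expansive k -> uniform_roe p1 X T ->
  uniform_roe p1 Y (conjugate_operator h k T).
Proof.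
move=> hK kK expk [bT clT]; split; first exact: conjugate_bounded.
move=> e e0; have [S fpS TS] := clT e e0.
have bS : bounded_operator S by case: fpS.
exists (conjugate_operator h k S).
  move: fpS => /finite_propagationP[_ [r r0 Sr]].
  apply/finite_propagationP; split; first exact: conjugate_bounded.
  have [s s0 rs] := expk r r0; exists s => // x y.
  rewrite /matrix_entry /conjugate_operator/= (comp_operator_delta kK hK).
  rewrite (comp_operatorE hK kK) => /Sr/rs.
  by rewrite !hK.
have -> : conjugate_operator h k T - conjugate_operator h k S =
    conjugate_operator h k (T - S).
  apply/funext => f; rewrite -[RHS]/(comp_operator h (T _ - S _)).
  by rewrite (linear_mapB (comp_operator_linear hK kK)).
exact: le_lt_trans (opnorm_conjugate_le hK kK (bounded_operatorB bT bS)) TS.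
Qed.

Lemma conjugate_linfty {X Y : metricType R} (h : Y -> X) (k : X -> Y)
    (T : lp p1 X -> lp p1 X) : cancel h k -> cancel k h ->
  linfty p1 X T -> linfty p1 Y (conjugate_operator h k T).
Proof.
move=> hK kK /linftyP[a [M [M0 aM ->]]]; apply/linftyP; exists (a \o h), M.
have ahM : bounded_by M (a \o h) by move=> y; exact: aM.
split=> //; apply/funext => f; apply: lp_ext => y.
rewrite (mul_operatorE ahM) /conjugate_operator/= (comp_operatorE hK kK).
by rewrite (mul_operatorE aM) (comp_operatorE kK hK) hK.
Qed.

Lemma conjugate_isometric_isomorphism {X Y : metricType R} (h : Y -> X) (k : X -> Y) :
  cancel h k -> cancel k h -> uniformly_expansive h -> uniformly_expansive k ->
  isometric_isomorphism (uniform_roe p1 X) (uniform_roe p1 Y) (conjugate_operator h k).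
Proof.
move=> hK kK exph expk; split.
- split.
  + by move=> T; exact: conjugate_roe.
  + by move=> S T _ _; exact: can_inj (conjugate_operatorK hK kK) _ _.
  + move=> T roeT; exists (conjugate_operator k h T); first exact: conjugate_roe.
    exact: conjugate_operatorK.
- move=> c S T _ _; apply/funext => f.
  rewrite -[LHS]/(comp_operator h (c *: S _ + T _)).
  by rewrite (comp_operator_linear hK kK).
- by move=> S T _ _; apply/funext => f; rewrite /conjugate_operator/= comp_operatorK.
- move=> T [bT _]; apply/le_anti; rewrite opnorm_conjugate_le//=.
  (* The reverse inequality is the same bound for the inverse conjugation. *)
  rewrite -{1}[T](conjugate_operatorK hK kK).
  by apply: opnorm_conjugate_le => //; exact: conjugate_bounded.
Qed.

Lemma conjugate_linfty_image {X Y : metricType R} (h : Y -> X) (k : X -> Y) :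
  cancel h k -> cancel k h ->
  conjugate_operator h k @` linfty p1 X = linfty p1 Y.
Proof.
move=> hK kK; apply/seteqP; split=> [_ [T lT <-]|T lT]; first exact: conjugate_linfty.
by exists (conjugate_operator k h T); [exact: conjugate_linfty|exact: conjugate_operatorK].
Qed.

End conjugation.

(** The inverse [h] of the bijection may differ from the coarse inverse [g]. But g(f x) is within
    [d] of x, and x = h y shows that g y is within [d] of h y. Hence [h] is expansive as well, at
    the cost of two extra terms [d]. *)
Lemma bijective_coarse_equivalenceP {R : realType} (X Y : metricType R) :
  bijectively_coarsely_equivalent X Y <->
  exists f : X -> Y, exists g : Y -> X,
    [/\ cancel f g, cancel g f, uniformly_expansive f & uniformly_expansive g].
Proof.
split.
  move=> [f [[h fK hK] [expf [g [expg [c c0 fgc] [d d0 gfd]]]]]]; exists f, h; split=> //.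
  move=> r r0; have [s s0 rs] := expg r r0; exists (d + (s + d)).
    by rewrite !addr_gt0.
  move=> y1 y2 /rs gy; apply: le_trans (metric_triangle _ (g y1) _) _.
  have hg y : mdist (g y) (h y) <= d by have := gfd (h y); rewrite /= hK.
  rewrite lerD//; first by rewrite metric_sym.
  by apply: le_trans (metric_triangle _ (g y2) _) _; rewrite lerD.
move=> [f [g [fK gK expf expg]]]; exists f; split; first by exists g.
split=> //; exists g; split=> //; exists 1 => // x.
  by rewrite /= gK mdistxx.
by rewrite /= fK mdistxx.
Qed.

(** * Lamperti's argument: isometries preserve disjointness of supports *)

Section lamperti.
Context {R : realType} {p : R} {p1 : 1 <= p} {X : choiceType}.
Hypothesis p2 : p <> 2.
Implicit Types (S : lp p1 X -> lp p1 X) (f g : lp p1 X) (x y z : X).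

Let p0 : 0 < p. Proof. exact: lt_le_trans p1. Qed.

Definition disjoint_support f g := forall x, (f x == 0) || (g x == 0).

Let EFin_sum f g :
  (\esum_(x in [set: X]) (normc (f x) `^ p + normc (g x) `^ p)%:E =
   (rnorm f `^ p + rnorm g `^ p)%:E)%E.
Proof.
rewrite [RHS](_ : _ = lp_sum p f + lp_sum p g)%E; last first.
  by rewrite (lp_sum_rnorm f) (lp_sum_rnorm g).
rewrite /lp_sum -esumD => [|x _|x _]; rewrite ?lee_fin ?powR_ge0//.
Qed.

Let EFin_sum2 f g :
  (\esum_(x in [set: X]) (2 * (normc (f x) `^ p + normc (g x) `^ p))%:E =
   (2 * (rnorm f `^ p + rnorm g `^ p))%:E)%E.
Proof.
rewrite EFinM -EFin_sum -esumZl// => x.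
by rewrite lee_fin addr_ge0// powR_ge0.
Qed.

(* The case of equality in Clarkson's inequality. *)
Lemma disjoint_supportP f g : disjoint_support f g <->
  rnorm (f + g) `^ p + rnorm (f - g) `^ p = 2 * (rnorm f `^ p + rnorm g `^ p).
Proof.
split=> [fg|fgE].
  suff: ((rnorm (f + g) `^ p + rnorm (f - g) `^ p)%:E =
      (2 * (rnorm f `^ p + rnorm g `^ p))%:E)%E by case.
  rewrite -(EFin_sum (f + g) (f - g)) -(EFin_sum2 f g); apply: eq_esum => x _; congr EFin.
  by apply/eqP; rewrite -subr_eq0; apply/eqP/(clarkson_gap_eq0 p0 (fg x)).
have sumE := etrans (EFin_sum (f + g) (f - g))
  (etrans (congr1 EFin fgE) (esym (EFin_sum2 f g))).
have gapE x : normc ((f + g) x) `^ p + normc ((f - g) x) `^ p =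
    2 * (normc (f x) `^ p + normc (g x) `^ p) + clarkson_gap p (f x) (g x).
  by rewrite /clarkson_gap subrKC.
have gap0 x : (f x == 0) || (g x == 0) -> clarkson_gap p (f x) (g x) = 0.
  exact: clarkson_gap_eq0.
(* For [p <> 2] the gap is nonzero wherever both coordinates are nonzero. *)
suff gap_eq0 x : clarkson_gap p (f x) (g x) = 0.
  move=> x; apply/negPn/negP; rewrite negb_or => /andP[fx gx].
  have [plt|pgt|//] := ltgtP p 2.
    have := @clarkson_gap_lt0 _ p _ _ _ fx gx.
    by rewrite p0 plt gap_eq0 ltxx => /(_ isT).
  by have := clarkson_gap_gt0 pgt fx gx; rewrite gap_eq0 ltxx.
(* On either side of [2] the gap has a constant sign, so one summand dominates the other at every
   point; equality of the finite sums then forces pointwise equality. *)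
have [plt|pgt|//] := ltgtP p 2.
- have gap_le0 y : clarkson_gap p (f y) (g y) <= 0.
    have [/gap0->//|] := boolP ((f y == 0) || (g y == 0)).
    by rewrite negb_or => /andP[fy gy]; rewrite ltW// clarkson_gap_lt0// p0.
  have := @esum_eq_pointwise _ _ _ _ _ _ sumE x; rewrite gapE => gapx.
  apply: (addrI (2 * (normc (f x) `^ p + normc (g x) `^ p))); rewrite addr0.
  apply: gapx => [y|]; last by rewrite (EFin_sum2 f g) ltry.
  by rewrite addr_ge0 ?powR_ge0//= gapE gerDl.
- have gap_ge0 y : 0 <= clarkson_gap p (f y) (g y).
    have [/gap0->//|] := boolP ((f y == 0) || (g y == 0)).
    by rewrite negb_or => /andP[fy gy]; rewrite ltW// clarkson_gap_gt0.
  have := @esum_eq_pointwise _ _ _ _ _ _ (esym sumE) x; rewrite gapE => gapx.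
  apply: (addrI (2 * (normc (f x) `^ p + normc (g x) `^ p))); rewrite addr0.
  apply: esym; apply: gapx => [y|]; last by rewrite (EFin_sum (f + g) (f - g)) ltry.
  by rewrite mulr_ge0 ?addr_ge0 ?powR_ge0//= gapE lerDl.
Qed.

(** Disjointness is expressed by an identity between norms of [f], [g], [f + g] and [f - g], which a
    linear isometry respects. *)
Lemma isometry_disjoint_support S f g : linear S ->
  (forall h, rnorm (S h) = rnorm h) ->
  disjoint_support f g -> disjoint_support (S f) (S g).
Proof.
move=> linS isoS /disjoint_supportP fg; apply/disjoint_supportP.
by rewrite -(linear_mapD linS) -(linear_mapB linS) !isoS.
Qed.

(** Columns [x] and [y] of [S] have disjoint supports, and column [x] is already nonzero in row
    [x]. *)
Lemma isometry_diagonal S : bounded_operator S ->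
  (forall h, rnorm (S h) = rnorm h) ->
  (forall x, matrix_entry S x x != 0) ->
  forall x y, x != y -> matrix_entry S x y = 0.
Proof.
move=> bS isoS Sxx x y xy.
have dxy : disjoint_support (delta p1 x) (delta p1 y).
  move=> z; rewrite !deltaE; have [->|] := eqVneq z x; last by rewrite eqxx.
  by rewrite (negPf xy) eqxx orbT.
have := isometry_disjoint_support (bounded_linear bS) isoS dxy x.
by rewrite [_ == 0](negPf (Sxx x)) => /eqP.
Qed.

End lamperti.

(** * Small real numbers as real parts of unimodular numbers near i *)

Section unimodular_decomposition.
Context {R : realType}.
Implicit Type t : R.

(** For t in [-1, 1], the point of the upper unit semicircle with real part [t]. *)
Definition arc t : R[i] := t +i* Num.sqrt (1 - t ^+ 2).

Let arc_bound t : `|t| <= 2^-1 -> 0 <= 1 - t ^+ 2 /\ 4 / 5 <= Num.sqrt (1 - t ^+ 2).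
Proof.
move=> t2; have t2' : t ^+ 2 <= 4^-1.
  rewrite -real_normK ?num_real//.
  have -> : 4^-1 = 2^-1 ^+ 2 :> R by rewrite expr2; field.
  by rewrite lerXn2r ?nnegrE// invr_ge0.
split; first by lra.
have -> : 4 / 5 = Num.sqrt ((4 / 5) ^+ 2) :> R by rewrite sqrtr_sqr ger0_norm// divr_ge0.
by rewrite ler_wsqrtr// expr2; lra.
Qed.

Lemma normc_conj (z : R[i]) : normc (z^*)%C = normc z.
Proof. by case: z => x y /=; rewrite sqrrN. Qed.

Lemma normc_arc t : `|t| <= 2^-1 -> normc (arc t) = 1.
Proof. by move=> /arc_bound[t0 _]; rewrite /= sqr_sqrtr// subrKC sqrtr1. Qed.

(** The squared distance is 2 - 2 sqrt(1 - t^2). The lower bound 4/5 on the root makes it at most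
    2/5, which is less than (9/10)^2. Any constant below 1 would serve the later argument. *)
Lemma arc_near_i t : `|t| <= 2^-1 -> normc (arc t - 'i%C) <= 9 / 10.
Proof.
move=> /arc_bound[t0 tb].
have -> : 9 / 10 = Num.sqrt ((9 / 10) ^+ 2) :> R by rewrite sqrtr_sqr ger0_norm// divr_ge0.
rewrite /= ler_wsqrtr//; set s := Num.sqrt _ in tb *.
have sE : s ^+ 2 = 1 - t ^+ 2 by rewrite sqr_sqrtr.
have -> : (t - 0) ^+ 2 + (s - 1) ^+ 2 = t ^+ 2 + s ^+ 2 + 1 - 2 * s by ring.
by rewrite sE expr2; lra.
Qed.

Lemma arc_conj_near_i t : `|t| <= 2^-1 -> normc ((arc t)^*%C - - 'i%C) <= 9 / 10.
Proof.
move=> tb; rewrite -normc_conj; apply: le_trans (arc_near_i tb).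
rewrite [X in normc X](_ : _ = arc t - 'i%C)//.
by rewrite /arc/=; congr (_ +i* _); ring.
Qed.

Lemma arc_addJ t : arc t + (arc t)^*%C = (2 * t)%:C.
Proof. by rewrite /arc/=; congr (_ +i* _); [ring|rewrite subrr]. Qed.

End unimodular_decomposition.

(** * Isometric isomorphisms preserve [linfty] when [p <> 2] *)

Section isomorphisms_preserve_linfty.
Context {R : realType} {p : R} {p1 : 1 <= p}.

Lemma linfty_lin {X : metricType R} (c : R[i]) (S T : lp p1 X -> lp p1 X) :
  linfty p1 X S -> linfty p1 X T -> linfty p1 X (c *: S + T).
Proof.
move=> /linftyP[a [M [M0 aM ->]]] /linftyP[b [N [N0 bN ->]]].
have cabMN : bounded_by (normc c * M + N) (fun x => c * a x + b x).
  move=> x; apply: le_trans (le_normcD _ _) _.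
  by rewrite Normc.normcM lerD// ler_wpM2l ?normc_ge0.
apply/linftyP; exists (fun x => c * a x + b x), (normc c * M + N); split=> //.
  by rewrite addr_ge0 ?mulr_ge0 ?normc_ge0.
apply/funext => f; apply: lp_ext => x; rewrite (mul_operatorE cabMN).
rewrite -[LHS]/(c * mul_operator a f x + mul_operator b f x).
by rewrite (mul_operatorE aM) (mul_operatorE bN) mulrDl mulrA.
Qed.

Context {X Y : metricType R} {phi : (lp p1 X -> lp p1 X) -> (lp p1 Y -> lp p1 Y)}.
Hypothesis isophi : isometric_isomorphism (uniform_roe p1 X) (uniform_roe p1 Y) phi.

(** Unitality follows from surjectivity: if phi(T) = id, then phi(id) = phi(id) phi(T) = phi(T) =
    id. *)
Lemma isomorphism_id : phi id = id.
Proof.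
have [bX X1 _ _] := @uniform_roe_algebra R p p1 X.
have [_ Y1 _ _] := @uniform_roe_algebra R p p1 Y.
case: isophi => [[_ _ surphi] _ compphi _].
have [T roeT TE] := surphi _ Y1.
have TE1 : phi id = phi id \o phi T by rewrite TE.
exact: etrans TE1 (etrans (esym (compphi _ _ X1 roeT)) TE).
Qed.

Hypothesis p2 : p <> 2.

(** Multiplication by [a] and by its inverse are contractions, and so are their images; hence the
    image of [a] is an isometry. Being close to the scalar [c] keeps its diagonal away from zero,
    and [isometry_diagonal] applies. *)
Lemma unimodular_image_linfty (a : X -> R[i]^o) (c : R[i]) :
  normc c = 1 -> (forall x, normc (a x) = 1) ->
  (forall x, normc (a x - c) <= 9 / 10) -> linfty p1 Y (phi (mul_operator a)).
Proof.
move=> c1 a1 ac; pose b : X -> R[i]^o := fun x => (a x)^-1.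
have [bX X1 linX _] := @uniform_roe_algebra R p p1 X.
have aM : bounded_by 1 a by move=> x; rewrite a1.
have bM : bounded_by 1 b by move=> x; rewrite /b Normc.normcV a1 invr1.
have a0 x : a x != 0.
  by apply/eqP => ax; have := a1 x; rewrite ax [normc _]Normc.normc0 => /esym/eqP; rewrite oner_eq0.
have roea : uniform_roe p1 X (mul_operator a).
  by apply: linfty_roe; exact: mul_operator_linfty aM.
have roeb : uniform_roe p1 X (mul_operator b).
  by apply: linfty_roe; exact: mul_operator_linfty bM.
have baE : mul_operator b \o mul_operator a = id :> (lp p1 X -> lp p1 X).
  apply/funext => f; apply: lp_ext => x /=.
  by rewrite (mul_operatorE bM) (mul_operatorE aM) mulKf.
case: isophi => [[mapphi _ _] linphi compphi normphi].
have bphia := uniform_roe_bounded (mapphi _ roea).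
have bphib := uniform_roe_bounded (mapphi _ roeb).
have na : opnorm (phi (mul_operator a)) <= 1.
  by rewrite normphi//; exact: opnorm_mul_operator aM.
have nb : opnorm (phi (mul_operator b)) <= 1.
  by rewrite normphi//; exact: opnorm_mul_operator bM.
have contract (T : lp p1 Y -> lp p1 Y) f :
    bounded_operator T -> opnorm T <= 1 -> rnorm (T f) <= rnorm f.
  move=> bT T1; apply: le_trans (le_opnorm f bT) _.
  by rewrite ler_piMl// rnorm_ge0.
have phibaE : phi (mul_operator b) \o phi (mul_operator a) = id :=
  etrans (esym (compphi _ _ roeb roea)) (etrans (congr1 phi baE) isomorphism_id).
have isoa f : rnorm (phi (mul_operator a) f) = rnorm f.
  apply/le_anti/andP; split; first exact: contract.
  have := contract _ (phi (mul_operator a) f) bphib nb.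
  by rewrite -[X in rnorm X]/((phi (mul_operator b) \o phi (mul_operator a)) f) phibaE.
apply: diagonal_linfty => //; apply: (isometry_diagonal p2) => // y.
(* A zero diagonal entry at [y] would give the image of [a - c] an entry of modulus 1, although its
   norm is at most 9/10. *)
apply/eqP => ay0.
pose T : lp p1 X -> lp p1 X := - c *: id + mul_operator a.
have roeT : uniform_roe p1 X T by exact: (linX (- c) _ _ X1 roea).
have TE : T = mul_operator (fun x => a x - c).
  apply/funext => f; apply: lp_ext => x.
  rewrite (@mul_operatorE _ _ _ _ _ (9 / 10))//.
  rewrite -[LHS]/(- c * f x + mul_operator a f x) (mul_operatorE aM).
  by rewrite mulrBl addrC mulNr.
have nT : opnorm (phi T) <= 9 / 10.
  by rewrite normphi// TE; apply: opnorm_mul_operator => //; rewrite divr_ge0.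
have phiTE : phi T = - c *: id + phi (mul_operator a) :=
  etrans (linphi _ _ _ X1 roea)
    (congr1 (fun S => - c *: S + phi (mul_operator a)) isomorphism_id).
have Tyy : matrix_entry (phi T) y y = - c.
  transitivity (- c * delta p1 y y + matrix_entry (phi (mul_operator a)) y y).
    by rewrite phiTE.
  by rewrite ay0 addr0 deltaE eqxx mulr1.
have := matrix_entry_le y y (uniform_roe_bounded (mapphi _ roeT)).
rewrite Tyy normcN c1 => /le_trans/(_ nT).
by rewrite ler_pdivlMr// mul1r ler_nat.
Qed.

Lemma isomorphism_linfty_sub T : linfty p1 X T -> linfty p1 Y (phi T).
Proof.
move=> /linftyP[a [M [M0 aM ->]]].
(* Dividing by [N] brings real and imaginary parts down to at most 1/2; the added [1] keeps [N]
   positive when [M = 0]. *)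
pose N := 2 * M + 1.
have N0 : 0 < N by rewrite /N ltr_wpDl// mulr_ge0.
have small (t : R) : `|t| <= M -> `|t / N| <= 2^-1.
  move=> tM; rewrite normrM normfV (ger0_norm (ltW N0)) ler_pdivrMr//.
  by apply: le_trans tM _; rewrite /N; lra.
have reM x : `|complex.Re (a x) / N| <= 2^-1.
  apply: small; apply: le_trans (aM x).
  by rewrite -lecR; exact: normc_ge_Re.
have imM x : `|complex.Im (a x) / N| <= 2^-1.
  apply: small; apply: le_trans (aM x).
  by case: (a x) => u v /=; rewrite -sqrtr_sqr ler_wsqrtr// lerDr sqr_ge0.
pose u1 x : R[i]^o := arc (complex.Re (a x) / N).
pose u2 x : R[i]^o := (arc (complex.Re (a x) / N))^*%C.
pose u3 x : R[i]^o := arc (complex.Im (a x) / N).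
pose u4 x : R[i]^o := (arc (complex.Im (a x) / N))^*%C.
have u1M : bounded_by 1 u1 by move=> x; rewrite normc_arc.
have u2M : bounded_by 1 u2 by move=> x; rewrite normc_conj normc_arc.
have u3M : bounded_by 1 u3 by move=> x; rewrite normc_arc.
have u4M : bounded_by 1 u4 by move=> x; rewrite normc_conj normc_arc.
have i1 : normc ('i%C : R[i]) = 1 by rewrite /= expr0n expr1n add0r sqrtr1.
have l1 : linfty p1 Y (phi (mul_operator u1)).
  apply: (@unimodular_image_linfty _ 'i%C) => // x; first exact: normc_arc.
  exact: arc_near_i.
have l2 : linfty p1 Y (phi (mul_operator u2)).
  apply: (@unimodular_image_linfty _ (- 'i%C)) => [|x|x]; first by rewrite normcN.
    by rewrite normc_conj normc_arc.
  exact: arc_conj_near_i.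
have l3 : linfty p1 Y (phi (mul_operator u3)).
  apply: (@unimodular_image_linfty _ 'i%C) => // x; first exact: normc_arc.
  exact: arc_near_i.
have l4 : linfty p1 Y (phi (mul_operator u4)).
  apply: (@unimodular_image_linfty _ (- 'i%C)) => [|x|x]; first by rewrite normcN.
    by rewrite normc_conj normc_arc.
  exact: arc_conj_near_i.
have u12 x : u1 x + u2 x = (2 * (complex.Re (a x) / N))%:C by exact: arc_addJ.
have u34 x : u3 x + u4 x = (2 * (complex.Im (a x) / N))%:C by exact: arc_addJ.
clearbody u1 u2 u3 u4.
have [_ _ linX _] := @uniform_roe_algebra R p p1 X.
case: isophi => [_ linphi _ _].
pose P S := uniform_roe p1 X S /\ linfty p1 Y (phi S).
have Plin c S1 S2 : P S1 -> P S2 -> P (c *: S1 + S2).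
  move=> [roe1 P1] [roe2 P2]; split; first exact: (linX c _ _ roe1 roe2).
  by rewrite (linphi c _ _ roe1 roe2); exact: linfty_lin.
have Pu u : bounded_by 1 u -> linfty p1 Y (phi (mul_operator u)) -> P (mul_operator u).
  by move=> uM lu; split=> //; apply: linfty_roe; exact: mul_operator_linfty uM.
(* This is the operator of i(u3 + u4) + (u1 + u2), which equals (2/N)a. *)
have PE := Plin 'i%C _ _ (Plin 1 _ _ (Pu _ u3M l3) (Pu _ u4M l4))
  (Plin 1 _ _ (Pu _ u1M l1) (Pu _ u2M l2)).
(* [Plin] only forms c S1 + S2, so the multiple by N/2 is taken as (N/2 - 1)S + S. *)
have [_] := Plin ((N / 2)%:C - 1) _ _ PE PE.
rewrite [X in phi X](_ : _ = mul_operator a)//.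
apply/funext => f; apply: lp_ext => x.
transitivity (((N / 2)%:C - 1) * ('i%C * (1 * mul_operator u3 f x + mul_operator u4 f x) +
    (1 * mul_operator u1 f x + mul_operator u2 f x)) +
  ('i%C * (1 * mul_operator u3 f x + mul_operator u4 f x) +
    (1 * mul_operator u1 f x + mul_operator u2 f x))) => //.
move: (mul_operatorE aM f x) (mul_operatorE u1M f x) (mul_operatorE u2M f x).
move: (mul_operatorE u3M f x) (mul_operatorE u4M f x).
move: (mul_operator u3 f x) (mul_operator u4 f x) (mul_operator a f x)
  (mul_operator u1 f x) (mul_operator u2 f x) => m3 m4 m m1 m2 -> -> -> -> ->.
transitivity ((N / 2)%:C * ('i%C * (u3 x + u4 x) + (u1 x + u2 x)) * f x); first by ring.
rewrite u12 u34; congr (_ * _).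
have NK t : N / 2 * (2 * (t / N)) = t by field; rewrite gt_eqF.
transitivity ((N / 2 * (2 * (complex.Re (a x) / N)))%:C +
    'i%C * (N / 2 * (2 * (complex.Im (a x) / N)))%:C); last by rewrite !NK -complexE.
by rewrite [in RHS]rmorphM [in X in 'i%C * X]rmorphM; ring.
Qed.

End isomorphisms_preserve_linfty.

Lemma isomorphism_linfty_image {R : realType} {p : R} {p1 : 1 <= p}
    {X Y : metricType R} (phi : (lp p1 X -> lp p1 X) -> (lp p1 Y -> lp p1 Y)) :
  p <> 2 -> isometric_isomorphism (uniform_roe p1 X) (uniform_roe p1 Y) phi ->
  phi @` linfty p1 X = linfty p1 Y.
Proof.
move=> p2 isophi; have [psi [isopsi _ psiK]] :=
  isometric_isomorphism_inv uniform_roe_algebra isophi.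
apply/seteqP; split=> [_ [T lT <-]|T lT]; first exact: isomorphism_linfty_sub.
exists (psi T); first exact: isomorphism_linfty_sub.
by apply: psiK; rewrite inE; exact: linfty_roe.
Qed.

(** * The bounded operator attached to the relation of being at distance at most [r] *)

Lemma esum_exchange {R : realType} {T1 T2 : choiceType} (a : T1 -> T2 -> \bar R) :
  (forall x y, 0 <= a x y)%E ->
  (\esum_(x in [set: T1]) \esum_(y in [set: T2]) a x y =
   \esum_(y in [set: T2]) \esum_(x in [set: T1]) a x y)%E.
Proof.
move=> a0; rewrite !esum_esum//.
rewrite (reindex_esum ([set: T2] `*`` (fun=> [set: T1])) _ (fun z => (z.2, z.1)))//.
split=> //=; first by move=> [y x] [y' x'] _ _ [-> ->].
by move=> [x y] _; exists (y, x).
Qed.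

Section powers_of_sums.
Context {R : realType}.

Lemma normc_sum_le (X : Type) (s : seq X) (u : X -> R[i]) :
  normc (\sum_(y <- s) u y) <= \sum_(y <- s) normc (u y).
Proof.
elim: s => [|y s IH]; first by rewrite !big_nil Normc.normc0.
by rewrite !big_cons (le_trans (le_normcD _ _))// lerD2l.
Qed.

(** Each term is at most the p-th root of the sum of the p-th powers, and there are at most [N]
    terms. The constant is crude, but only boundedness is needed. *)
Lemma powR_sum_le (p : R) (X : eqType) (s : seq X) (N : nat) (u : X -> R) :
  1 <= p -> (size s <= N)%N -> (forall y, 0 <= u y) ->
  (\sum_(y <- s) u y) `^ p <= N%:R `^ p * \sum_(y <- s) u y `^ p.
Proof.
move=> p1 sN u0; have p0 : 0 < p by exact: lt_le_trans p1.
set S := \sum_(y <- s) u y `^ p.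
have S0 : 0 <= S by apply: sumr_ge0 => y _; exact: powR_ge0.
have S'0 : 0 <= S `^ p^-1 by exact: powR_ge0.
have uS y : y \in s -> u y <= S `^ p^-1.
  move=> ys; rewrite -[leLHS](powRr1 (u0 y)) -(mulfV (lt0r_neq0 p0)) powRrM.
  rewrite ge0_ler_powR ?nnegrE ?powR_ge0 ?invr_ge0 ?(ltW p0)//.
  by rewrite /S (big_rem y)//= lerDl sumr_ge0// => z _; exact: powR_ge0.
have sumS : \sum_(y <- s) u y <= N%:R * S `^ p^-1.
  apply: (@le_trans _ _ (\sum_(y <- s) S `^ p^-1)).
    by rewrite big_seq [leRHS]big_seq ler_sum.
  by rewrite big_const_seq count_predT iter_addr_0 -[leLHS]mulr_natl ler_wpM2r// ler_nat.
have -> : N%:R `^ p * S = (N%:R * S `^ p^-1) `^ p.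
  by rewrite powRM// -powRrM mulVf ?gt_eqF// powRr1.
by rewrite ge0_ler_powR ?nnegrE ?(ltW p0) ?sumr_ge0// mulr_ge0.
Qed.

End powers_of_sums.

Section neighbourhood_operator.
Context {R : realType} {p : R} {p1 : 1 <= p} {X : metricType R}.
Context (r : R) (N : nat).
Hypothesis r0 : 0 < r.
Hypothesis ballN : forall x : X, ([set y | mdist x y <= r] #<= `I_N)%card.

(** An enumeration of the ball, so that sums over it are finite sums; [fset_set] is meaningful here
    because [ballN] makes balls finite. *)
Definition neighbours (x : X) : seq X :=
  finmap.enum_fset (fset_set [set y | mdist x y <= r]).

Let finite_ball (x : X) : finite_set [set y | mdist x y <= r].
Proof. by apply/finite_set_leP; exists N. Qed.

Lemma mem_neighbours x y : (y \in neighbours x) = (mdist x y <= r).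
Proof. by rewrite /neighbours in_fset_set//; apply/idP/idP; rewrite inE. Qed.

Lemma size_neighbours x : (size (neighbours x) <= N)%N.
Proof. exact: geq_card_fset_set. Qed.

Lemma esum_neighbours (g : X -> R) x : (forall y, 0 <= g y) ->
  (\esum_(y in [set: X]) (if y \in neighbours x then (g y)%:E else 0) =
   (\sum_(y <- neighbours x) g y)%:E)%E.
Proof.
pose B := [set y | mdist x y <= r]; move=> g0.
transitivity (\esum_(y in B) (g y)%:E)%E.
  rewrite [RHS]esum_mkcond; apply: eq_esum => y _.
  by rewrite mem_neighbours; congr (if _ then _ else _); apply/idP/idP; rewrite inE.
have finB : finite_set B by exact: finite_ball.
rewrite (esum_fset finB) => [|y _]; last by rewrite lee_fin.
by rewrite fsbig_finite// sumEFin.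
Qed.

Definition neighbourhood_operator (f : lp p1 X) : lp p1 X :=
  lp_of (fun x => \sum_(y <- neighbours x) f y).

(** [powR_sum_le] handles each row; after exchanging the two sums, each coordinate of [f] is counted
    at most [N] times. The two estimates account for the two factors [N.+1]. *)
Let lp_sum_neighbours (f : lp p1 X) :
  (lp_sum p (fun x => (\sum_(y <- neighbours x) f y)%R) <=
   ((N.+1%:R * N.+1%:R * rnorm f) `^ p)%:E)%E.
Proof.
pose v y := normc (f y) `^ p.
have v0 y : 0 <= v y by exact: powR_ge0.
(* [N.+1] keeps the base at least 1, where raising to the power [p] does not decrease it. *)
have Np : N%:R <= N.+1%:R `^ p.
  by apply: (@le_trans _ _ N.+1%:R); rewrite ?ler_nat// le1r_powR// ler1n.
apply: (@le_trans _ _ (\esum_(x in [set: X])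
    ((N.+1%:R `^ p)%:E * (\sum_(y <- neighbours x) v y)%R%:E))%E).
  apply: le_esum => x _; rewrite -EFinM lee_fin.
  apply: (@le_trans _ _ ((\sum_(y <- neighbours x) normc (f y)) `^ p)).
    rewrite ge0_ler_powR ?nnegrE ?normc_ge0 ?(le_trans _ p1)//.
      by apply: sumr_ge0 => y _; exact: normc_ge0.
    exact: normc_sum_le.
  apply: powR_sum_le => // [|y]; last exact: normc_ge0.
  by apply: leq_trans (size_neighbours x) _.
rewrite esumZl ?powR_ge0//; last by move=> x; rewrite lee_fin sumr_ge0.
rewrite !powRM ?mulr_ge0 ?rnorm_ge0// -mulrA EFinM.
apply: lee_wpmul2l; first by rewrite lee_fin powR_ge0.
have -> : (\esum_(x in [set: X]) (\sum_(y <- neighbours x) v y)%R%:E =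
    \esum_(x in [set: X]) \esum_(y in [set: X])
      (if y \in neighbours x then (v y)%:E else 0))%E.
  by apply: eq_esum => x _; rewrite esum_neighbours.
rewrite esum_exchange; last by move=> x y; case: ifP => // _; rewrite lee_fin.
rewrite EFinM -(lp_sum_rnorm f) /lp_sum -esumZl ?powR_ge0//.
apply: le_esum => y _.
(* By symmetry of the distance, column [y] has the same support as row [y]. *)
rewrite (_ : \esum_(x in _) _ = (\sum_(x <- neighbours y) v y)%:E); last first.
  rewrite -(@esum_neighbours (fun=> v y))//; apply: eq_esum => x _.
  by rewrite !mem_neighbours metric_sym.
rewrite -EFinM lee_fin big_const_seq count_predT iter_addr_0 -[leLHS]mulr_natl.
rewrite ler_wpM2r//; apply: le_trans Np.
by rewrite ler_nat size_neighbours.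
Qed.

Lemma neighbourhood_operatorE f x :
  neighbourhood_operator f x = \sum_(y <- neighbours x) f y.
Proof.
by rewrite /neighbourhood_operator lp_ofE//; apply: le_lt_trans (lp_sum_neighbours f) (ltry _).
Qed.

Lemma neighbourhood_operator_bounded : bounded_operator neighbourhood_operator.
Proof.
apply/bounded_operatorP; split.
  move=> c f g; apply: lp_ext => x.
  transitivity (\sum_(y <- neighbours x) (c * f y + g y)).
    exact: neighbourhood_operatorE.
  rewrite big_split -mulr_sumr /=; apply: esym.
  by congr (c * _ + _); exact: neighbourhood_operatorE.
exists (N.+1%:R * N.+1%:R) => // f.
apply: rnorm_le; first by rewrite mulr_ge0 ?rnorm_ge0.
apply: le_trans (lp_sum_neighbours f); apply: le_esum => x _.
by rewrite neighbourhood_operatorE.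
Qed.

Lemma neighbourhood_operator_entry x y :
  matrix_entry neighbourhood_operator x y = ((mdist x y <= r)%R)%:R.
Proof.
rewrite /matrix_entry neighbourhood_operatorE -mem_neighbours.
have : uniq (neighbours x) by exact: finmap.fset_uniq.
elim: (neighbours x) => [|z s IH] /=; first by rewrite big_nil.
move=> /andP[zs us]; rewrite big_cons IH// inE -[X in X + _]/((z == y)%:R).
have [<-|zy] := eqVneq z y; first by rewrite (negPf zs) addr0.
by rewrite add0r.
Qed.

Lemma neighbourhood_operator_roe : uniform_roe p1 X neighbourhood_operator.
Proof.
apply: finite_propagation_roe; apply/finite_propagationP.
split; first exact: neighbourhood_operator_bounded.
exists r => // x y; rewrite neighbourhood_operator_entry.
by case: (mdist x y <= r); rewrite ?eqxx.
Qed.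

End neighbourhood_operator.

(** * Rank-one projections onto the basis vectors *)

Section point_projections.
Context {R : realType} {p : R} {p1 : 1 <= p} {X : choiceType}.
Implicit Types (T : lp p1 X -> lp p1 X) (f : lp p1 X) (x y z : X).

Definition point_projection x : lp p1 X -> lp p1 X := mul_operator (@delta_fun R X x).

Lemma delta_fun_bounded x : bounded_by 1 (@delta_fun R X x).
Proof.
move=> z; rewrite /delta_fun; case: (z == x); first by rewrite [normc _]Normc.normc1.
by rewrite [normc _]Normc.normc0.
Qed.

Lemma point_projectionE x f : point_projection x f = f x *: delta p1 x.
Proof.
apply: lp_ext => z; rewrite /point_projection (mul_operatorE (delta_fun_bounded x)).
rewrite lp_scaleE deltaE /delta_fun.
by have [->|_] := eqVneq z x; [rewrite mulr1 mul1r|rewrite mulr0 mul0r].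
Qed.

Lemma point_projection_inj x y :
  point_projection x = point_projection y -> x = y.
Proof.
move=> /(congr1 (fun T => matrix_entry T x x)); rewrite /matrix_entry.
rewrite !point_projectionE !lp_scaleE !deltaE eqxx mulr1.
by have [//|_] := eqVneq x y; rewrite mulr0 => /eqP; rewrite oner_eq0.
Qed.

Lemma point_projection_bounded x : bounded_operator (point_projection x).
Proof. by apply: (mul_operator_bounded _ (delta_fun_bounded x)). Qed.

Lemma corner_entry T x y : linear T ->
  matrix_entry (point_projection x \o T \o point_projection y) x y = matrix_entry T x y.
Proof.
move=> linT; rewrite /matrix_entry/= !point_projectionE (linear_mapZ linT).
by rewrite !lp_scaleE !deltaE !eqxx mulr1 mul1r.
Qed.

(** The corner is the rank-one operator f -> T_xy f(y) delta_x. The modulus of an entry is thereby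
    expressed through products and norms, which isometric isomorphisms preserve. *)
Lemma opnorm_corner T x y : bounded_operator T ->
  opnorm (point_projection x \o T \o point_projection y) = normc (matrix_entry T x y).
Proof.
move=> bT; have linT := bounded_linear bT.
apply/le_anti/andP; split; last first.
  rewrite -(corner_entry x y linT); apply: matrix_entry_le.
  apply: bounded_operator_comp (point_projection_bounded y).
  exact: bounded_operator_comp (point_projection_bounded x) bT.
apply: opnorm_le => [|f]; first exact: normc_ge0.
rewrite [X in rnorm X]/= !point_projectionE (linear_mapZ linT) rnormZ rnorm_delta.
rewrite mulr1 lp_scaleE Normc.normcM mulrC.
by rewrite ler_wpM2l ?normc_ge0// normc_entry.
Qed.

End point_projections.

Lemma point_projection_linfty {R : realType} {p : R} {p1 : 1 <= p}
  {X : metricType R} (x : X) : linfty p1 X (point_projection x).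
Proof. by apply: mul_operator_linfty (delta_fun_bounded x). Qed.

(** * The bijection of points induced by an isomorphism preserving [linfty] *)

Section linfty_isomorphisms.
Context {R : realType} {p : R} {p1 : 1 <= p} {X Y : metricType R}.
Context {phi : (lp p1 X -> lp p1 X) -> (lp p1 Y -> lp p1 Y)}.
Hypothesis isophi : isometric_isomorphism (uniform_roe p1 X) (uniform_roe p1 Y) phi.

Lemma isomorphismZ (c : R[i]) T : uniform_roe p1 X T -> phi (c *: T) = c *: phi T.
Proof.
case: isophi => [_ linphi _ _] roeT; have := linphi (c - 1) _ _ roeT roeT.
by rewrite -[X in _ + X]scale1r -scalerDl subrK -[X in _ = _ + X]scale1r -scalerDl subrK.
Qed.

(** Let [b] be the multiplier of the image, nonzero at [y], and let [a] be that of the preimage of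
    the projection at [y]. Minimality of the projection at [x] gives delta_y b = a(x) b. At [y] this
    yields a(x) = 1, elsewhere b = 0, and idempotence gives b(y) = 1. *)
Lemma point_projection_image x : phi @` linfty p1 X = linfty p1 Y ->
  exists y, phi (point_projection x) = point_projection y.
Proof.
move=> philinfty; case: (isophi) => [_ _ compphi normphi].
have lx := @point_projection_linfty _ _ p1 _ x; have roex := linfty_roe lx.
have /linftyP[b [M [M0 bM bE]]] : linfty p1 Y (phi (point_projection x)).
  by rewrite -philinfty; exists (point_projection x).
(* A zero multiplier would have norm 0, but [phi] preserves the norm of the projection, which is at
   least 1. *)
have [y by0] : exists y, b y != 0.
  apply: contrapT => /forallNP b0.
  have b0' : bounded_by 0 b.
    by move=> z; have /negP/negPn/eqP -> := b0 z; rewrite [normc _]Normc.normc0.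
  have := opnorm_mul_operator (p1 := p1) (lexx 0) b0'.
  rewrite -bE normphi// => /(le_trans (matrix_entry_le x x (point_projection_bounded x))).
  rewrite /matrix_entry point_projectionE lp_scaleE deltaE eqxx mulr1.
  by rewrite [normc _]Normc.normc1 ler10.
have [T lT Ty] : exists2 T, linfty p1 X T & phi T = point_projection y.
  have := @point_projection_linfty _ _ p1 _ y.
  by rewrite -philinfty => -[T lT TE]; exists T.
have roeT := linfty_roe lT.
have /linftyP[a [K [K0 aK aE]]] := lT.
have TxE : T \o point_projection x = a x *: point_projection x.
  apply/funext => f; apply: lp_ext => z.
  rewrite -[RHS]/(a x * point_projection x f z) /= point_projectionE aE.
  rewrite (mul_operatorE aK) lp_scaleE deltaE.
  by have [->//|_] := eqVneq z x; rewrite !mulr0.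
have ybE z : delta_fun y z * b z = a x * b z.
  have E : point_projection y \o mul_operator b = a x *: mul_operator b
      :> (lp p1 Y -> lp p1 Y).
    rewrite -Ty -bE; apply: etrans (esym (compphi _ _ roeT roex)) _.
    by rewrite TxE isomorphismZ.
  have := congr1 (fun S => matrix_entry S z z) E.
  rewrite /matrix_entry/= -[X in _ = X -> _]/(a x * mul_operator b (delta p1 z) z).
  rewrite (mul_operatorE (delta_fun_bounded y)) (mul_operatorE bM).
  by rewrite deltaE eqxx !mulr1.
have ax1 : a x = 1.
  by apply: (mulIf by0); rewrite -ybE /delta_fun eqxx.
have bb : b y * b y = b y.
  have E : mul_operator b \o mul_operator b = mul_operator b :> (lp p1 Y -> lp p1 Y).
    rewrite -bE; apply: etrans (esym (compphi _ _ roex roex)) _; congr phi.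
    apply/funext => f; rewrite /= !point_projectionE lp_scaleE.
    by rewrite deltaE eqxx mulr1.
  have := congr1 (fun S => matrix_entry S y y) E.
  rewrite /matrix_entry/= !(mul_operatorE bM).
  by rewrite deltaE eqxx !mulr1.
exists y; rewrite bE /point_projection; congr mul_operator; apply/funext => z.
have [->|zy] := eqVneq z y.
  by rewrite /delta_fun eqxx; apply: (mulIf by0); rewrite bb mul1r.
have := ybE z; rewrite ax1 mul1r /delta_fun (negPf zy).
by rewrite mul0r => <-.
Qed.

(** The corner of [T] at (x1, x2) goes to the corner of [phi T] at (f x1, f x2), so the two entries
    have the same modulus. *)
Lemma induced_map_expansive (f : X -> Y) : bounded_geometry X ->
  (forall x, phi (point_projection x) = point_projection (f x)) ->
  uniformly_expansive f.
Proof.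
move=> bgX phif r r0; have [N ballN] := bgX r (ltW r0).
case: (isophi) => [[mapphi _ _] _ compphi normphi].
pose T := @neighbourhood_operator R p p1 X r.
have roeT : uniform_roe p1 X T by exact: neighbourhood_operator_roe ballN.
have [bphiT clphiT] := mapphi _ roeT.
(* With error below 1, [S] cannot vanish at an entry where [phi T] has modulus 1. Its propagation
   bound [s] depends on [r] alone and not on the points. *)
have [S /finite_propagationP[bS [s s0 Ss]] TS] := clphiT 1 ltr01.
exists s => // x1 x2 x12; apply: Ss; apply/eqP => S0.
have roe1 (x : X) : uniform_roe p1 X (point_projection x).
  by apply: linfty_roe; exact: point_projection_linfty.
have [_ _ _ compX] := @uniform_roe_algebra R p p1 X.
have cornerE : phi (point_projection x1 \o T \o point_projection x2) =
    point_projection (f x1) \o phi T \o point_projection (f x2).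
  rewrite -!phif; apply: etrans (compphi _ _ (compX _ _ (roe1 x1) roeT) (roe1 x2)) _.
  by rewrite (compphi _ _ (roe1 x1) roeT).
have : normc (matrix_entry (phi T) (f x1) (f x2)) = 1.
  rewrite -(opnorm_corner _ _ bphiT) -cornerE normphi; last first.
    exact: compX _ _ (compX _ _ (roe1 x1) roeT) (roe1 x2).
  rewrite opnorm_corner; last exact: uniform_roe_bounded.
  by rewrite (neighbourhood_operator_entry ballN) x12 [normc _]Normc.normc1.
have : matrix_entry (phi T - S) (f x1) (f x2) = matrix_entry (phi T) (f x1) (f x2).
  rewrite -[RHS]subr0 -[in RHS]S0.
  by [].
move=> <- n1; have := matrix_entry_le (f x1) (f x2) (bounded_operatorB bphiT bS).
by rewrite n1 leNgt TS.
Qed.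

End linfty_isomorphisms.

(** The point maps induced by [phi] and by its inverse are mutually inverse, since a projection
    determines its point; each is expansive by the bounded geometry of its source. *)
Lemma linfty_isomorphism_coarse {R : realType} {p : R} {p1 : 1 <= p}
    {X Y : metricType R} (phi : (lp p1 X -> lp p1 X) -> (lp p1 Y -> lp p1 Y)) :
  bounded_geometry X -> bounded_geometry Y ->
  isometric_isomorphism (uniform_roe p1 X) (uniform_roe p1 Y) phi ->
  phi @` linfty p1 X = linfty p1 Y -> bijectively_coarsely_equivalent X Y.
Proof.
move=> bgX bgY isophi philinfty; have [psi [isopsi phiK psiK]] :=
  isometric_isomorphism_inv uniform_roe_algebra isophi.
have psilinfty : psi @` linfty p1 Y = linfty p1 X.
  apply/seteqP; split=> [_ [T + <-]|T lT].
    by rewrite -philinfty => -[S lS <-]; rewrite phiK// inE; exact: linfty_roe.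
  exists (phi T); first by rewrite -philinfty; exists T.
  by rewrite phiK// inE; exact: linfty_roe.
have /choice[f fE] := fun x => point_projection_image isophi x philinfty.
have /choice[g gE] := fun y => point_projection_image isopsi y psilinfty.
apply/bijective_coarse_equivalenceP; exists f, g; split.
- move=> x; apply: (@point_projection_inj _ _ p1); rewrite -gE -fE phiK// inE.
  by apply: linfty_roe; exact: point_projection_linfty.
- move=> y; apply: (@point_projection_inj _ _ p1); rewrite -fE -gE psiK// inE.
  by apply: linfty_roe; exact: point_projection_linfty.
- exact: induced_map_expansive bgX fE.
- exact: induced_map_expansive bgY gE.
Qed.

Theorem theorem2p6 (R : realType) (X Y : metricType R)
    (hX : bounded_geometry X) (hY : bounded_geometry Y) :
  [<-> bijectively_coarsely_equivalent X Y;
       forall (p : R) (p1 : 1 <= p), exists phi,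
         isometric_isomorphism (uniform_roe p1 X) (uniform_roe p1 Y) phi /\
         phi @` linfty p1 X = linfty p1 Y;
       forall (p : R) (p1 : 1 <= p),
         isometrically_isomorphic (uniform_roe p1 X) (uniform_roe p1 Y);
       exists (p : R) (p1 : 1 <= p), p <> 2 /\
         isometrically_isomorphic (uniform_roe p1 X) (uniform_roe p1 Y);
       exists (p : R) (p1 : 1 <= p), exists phi,
         isometric_isomorphism (uniform_roe p1 X) (uniform_roe p1 Y) phi /\
         phi @` linfty p1 X = linfty p1 Y].
Proof.
tfae.
- move=> /bijective_coarse_equivalenceP[f [g [fK gK expf expg]]] p p1.
  (* Vectors over [X] are transported to [Y] by composition with [g], so the inverse bijection comes
     first. *)
  exists (conjugate_operator g f); split.
    exact: conjugate_isometric_isomorphism gK fK expg expf.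
  exact: conjugate_linfty_image gK fK.
- by move=> iso p p1; have [phi [isophi _]] := iso p p1; exists phi.
- move=> iso; exists 1, (lexx 1); split; last exact: iso.
  by move/eqP; rewrite (eqr_nat R 1 2).
- move=> [p [p1 [p2 [phi isophi]]]]; exists p, p1, phi; split=> //.
  exact: isomorphism_linfty_image p2 isophi.
- move=> [p [p1 [phi [isophi philinfty]]]].
  exact: linfty_isomorphism_coarse hX hY isophi philinfty.
Qed.
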